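(* If $L$ is a locally countable Borel graph that contains neither a copy of any of the nine Beineke graphs $B_1,\dots,B_9$ nor a Borel copy of $\mathbb{K}_0$, then $\chi_B(L)\le\aleph_0$.
   Context: All graphs are simple (possibly infinite): a graph $G$ has a vertex set $V(G)$ and an edge set $E(G)\subseteq [V(G)]^2$, where $[X]^2$ is the set of 2-element subsets of $X$. For a standard Borel space $X$, $[X]^2$ carries the $\sigma$-algebra of all $A\subseteq[X]^2$ such that $\{(x,y)\in X^2 : x\ne y,\ \{x,y\}\in A\}$ is Borel in $X^2$; with it, $[X]^2$ is a standard Borel space. A Borel graph is a graph $G$ such that $V(G)$ is a standard Borel space and $E(G)$ is a Borel subset of $[V(G)]^2$. A graph is locally countable if every vertex has countably many neighbors. Borel graphs $G,H$ are Borel isomorphic if there is a graph isomorphism $V(G)\to V(H)$ that is a Borel function. For $U\subseteq V(G)$, $G[U]$ is the subgraph of $G$ induced by $U$. $G$ contains a copy of $H$ if $G[U]\cong H$ for some $U\subseteq V(G)$. A Borel graph $G$ contains a Borel copy of a Borel graph $H$ if there is a Borel set $U\subseteq V(G)$ such that $G[U]$ is Borel isomorphic to $H$. For a Borel graph $G$, the Borel chromatic number $\chi_B(G)$ is the smallest cardinality of a standard Borel space $X$ for which there is a Borel function $f:V(G)\to X$ with $f(x)\ne f(y)$ for all $xy\in E(G)$. $\mathcal{C}=\{0,1\}^{\mathbb{N}}$ is the Cantor space, and for $\alpha,\beta\in\mathcal{C}$, $\alpha\,\mathbb{E}_0\,\beta$ iff there is $m\in\mathbb{N}$ with $\alpha(n)=\beta(n)$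 for all $n\ge m$. $\mathbb{K}_0$ is the Borel graph with $V(\mathbb{K}_0)=\mathcal{C}$ and $E(\mathbb{K}_0)=\{\{\alpha,\beta\}\in[\mathcal{C}]^2:\alpha\,\mathbb{E}_0\,\beta\}$. The nine Beineke graphs (up to isomorphism) are: $B_1$: the claw $K_{1,3}$. $B_2$: vertices $a,b,c,d,e$; edges $ac,ad,ae,cd,ce,bd,be$. $B_3$: the wheel obtained from a 5-cycle by adding a vertex adjacent to all five cycle vertices. $B_4$: vertices $a,c,d,e,p,q$; edges $ac,ad,ae,cd,ce,dp,eq$. $B_5$: $B_4$ together with the edge $pq$. $B_6$: the square of the path on 6 vertices, i.e., vertices $1,\dots,6$ with $i,j$ adjacent iff $1\le|i-j|\le 2$. $B_7$: $K_5$ minus one edge. $B_8$: vertices $a,b,c,d,u,w$; edges $ab,au,aw,bu,bw,uw,cu,cw,cd$. $B_9$: $B_8$ together with the edges $du,dw$ (two copies of $K_4$ sharing exactly one edge). *)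

(* Defs.v *)
From HB Require Import structures.
From mathcomp Require Import all_boot all_order all_algebra.
From mathcomp Require Import all_classical all_reals all_analysis.

Set Implicit Arguments.
Unset Strict Implicit.
Unset Printing Implicit Defensive.

Import Order.TTheory GRing.Theory Num.Theory.

Local Open Scope classical_set_scope.
Local Open Scope card_scope.

(* The library's [measurableType]s and [completeType]s are pointed.  The empty
   space is standard Borel, and induced subgraphs live on subtypes, so measurable
   spaces are unpointed records here and completeness is spelled out. *)
Record mspace := MSpace {
  carrier :> Type;
  borel : set_system carrier;
  borel_sigma : sigma_algebra [set: carrier] borel
}.
Arguments borel : clear implicits.

Definition borel_fun (X Y : mspace) (f : X -> Y) : Prop :=
  forall B, borel Y B -> borel X (f @^-1` B).

Definition prod_borel (X Y : mspace) : set_system (X * Y) :=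
  <<s [set A `*` B | A in borel X & B in borel Y] >>.

Definition subspace_borel (X : mspace) (U : set X) : set_system (set_type U) :=
  preimage_set_system setT (@set_val _ U) (borel X).

Lemma subspace_borel_sigma (X : mspace) (U : set X) :
  sigma_algebra setT (@subspace_borel X U).
Proof. exact: sigma_algebra_preimage (borel_sigma X). Qed.

Definition submspace (X : mspace) (U : set X) : mspace :=
  MSpace (@subspace_borel_sigma X U).

Definition separable_complete (R : realType) (P : metricType R) : Prop :=
  (exists2 D : set P, countable D & dense D) /\
  (forall F : set_system P, ProperFilter F -> cauchy F -> exists p : P, F --> p).

Definition standard_borel (R : realType) (X : mspace) : Prop :=
  exists (P : metricType R) (f : X -> P),
    [/\ separable_complete P, bijective f &
        borel X = [set f @^-1` A | A in <<s @open P >>]].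

Record graph := Graph {
  vertex :> Type;
  adj : vertex -> vertex -> Prop;
  adj_sym : forall x y, adj x y -> adj y x;
  adj_irr : forall x, ~ adj x x
}.

Definition graph_iso (G H : graph) (f : G -> H) : Prop :=
  bijective f /\ forall x y, adj x y <-> adj (f x) (f y).

Definition isomorphic (G H : graph) : Prop := exists f : G -> H, graph_iso f.

Definition induced (G : graph) (U : set G) : graph :=
  @Graph (set_type U) (fun x y => adj (set_val x) (set_val y))
    (fun x y => @adj_sym G (set_val x) (set_val y))
    (fun x => @adj_irr G (set_val x)).

Definition contains_copy (G H : graph) : Prop :=
  exists U : set G, isomorphic (induced U) H.

Definition locally_countable (G : graph) : Prop :=
  forall x : G, countable [set y | adj x y].

(* A graph whose vertex set carries a sigma-algebra. *)
Record mgraph := MGraph {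
  mgraph_graph :> graph;
  vborel : set_system mgraph_graph;
  vborel_sigma : sigma_algebra [set: mgraph_graph] vborel
}.

Definition vspace (G : mgraph) : mspace := MSpace (vborel_sigma G).

(* A set E of unordered pairs is Borel in [V]^2 exactly when
   {(x, y) | x <> y, {x, y} \in E} is Borel in V * V: this is the set below, as
   adjacency is irreflexive. *)
Definition borel_graph (R : realType) (G : mgraph) : Prop :=
  standard_borel R (vspace G) /\
  prod_borel (X := vspace G) (Y := vspace G)
    [set xy : G * G | adj xy.1 xy.2].

Definition induced_mgraph (G : mgraph) (U : set G) : mgraph :=
  @MGraph (induced U) _ (@subspace_borel_sigma (vspace G) U).

Definition borel_isomorphic (G H : mgraph) : Prop :=
  exists f : G -> H,
    graph_iso f /\ borel_fun (X := vspace G) (Y := vspace H) f.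

Definition contains_borel_copy (G H : mgraph) : Prop :=
  exists U : set G, vborel U /\ borel_isomorphic (induced_mgraph U) H.

Definition borel_colorable (G : mgraph) (X : mspace) : Prop :=
  exists f : G -> X,
    borel_fun (X := vspace G) f /\ forall x y, adj x y -> f x <> f y.

(* X witnesses the Borel chromatic number of G: it equals the cardinality of X. *)
Definition borel_chromatic_number_is (R : realType) (G : mgraph) (X : mspace) :
    Prop :=
  [/\ standard_borel R X, borel_colorable G X &
      forall Y : mspace, standard_borel R Y -> borel_colorable G Y ->
        [set: X] #<= [set: Y]].

Definition borel_chromatic_number_le (R : realType) (G : mgraph) (K : Type) :
    Prop :=
  exists2 X : mspace, borel_chromatic_number_is R G X & [set: X] #<= [set: K].

Definition E0 (a b : cantor_space) : Prop :=
  exists m : nat, forall n : nat, (m <= n)%N -> a n = b n.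

Lemma E0_sym a b : E0 a b -> E0 b a.
Proof. by move=> [m ab]; exists m => n /ab. Qed.

Definition K0_graph : graph :=
  @Graph cantor_space (fun a b => a <> b /\ E0 a b)
    (fun a b H => conj (not_eq_sym (proj1 H)) (E0_sym (proj2 H)))
    (fun a H => proj1 H erefl).

Definition K0 : mgraph :=
  @MGraph K0_graph <<s @open cantor_space >> (smallest_sigma_algebra _ _).

Section EdgeList.
Variables (n : nat) (s : seq (nat * nat)).

Definition edge_list_adj (i j : 'I_n) : Prop :=
  (i != j) && (((i : nat, j : nat) \in s) || ((j : nat, i : nat) \in s)).

Lemma edge_list_adj_sym i j : edge_list_adj i j -> edge_list_adj j i.
Proof. by rewrite /edge_list_adj eq_sym orbC. Qed.

Lemma edge_list_adj_irr i : ~ edge_list_adj i i.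
Proof. by rewrite /edge_list_adj eqxx. Qed.

Definition edge_list_graph : graph :=
  Graph edge_list_adj_sym edge_list_adj_irr.
End EdgeList.

Definition B1 := edge_list_graph 4 [:: (0, 1); (0, 2); (0, 3)].

(* a, b, c, d, e = 0, 1, 2, 3, 4 *)
Definition B2 := edge_list_graph 5
  [:: (0, 2); (0, 3); (0, 4); (2, 3); (2, 4); (1, 3); (1, 4)].

Definition B3 := edge_list_graph 6
  [:: (0, 1); (1, 2); (2, 3); (3, 4); (4, 0);
      (5, 0); (5, 1); (5, 2); (5, 3); (5, 4)].

(* a, c, d, e, p, q = 0, 1, 2, 3, 4, 5 *)
Definition B4_edges : seq (nat * nat) :=
  [:: (0, 1); (0, 2); (0, 3); (1, 2); (1, 3); (2, 4); (3, 5)].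

Definition B4 := edge_list_graph 6 B4_edges.

Definition B5 := edge_list_graph 6 ((4, 5) :: B4_edges).

Definition B6 := edge_list_graph 6
  ([seq (i, i + 1) | i <- iota 0 5] ++ [seq (i, i + 2) | i <- iota 0 4]).

Definition B7 := edge_list_graph 5
  [:: (0, 2); (0, 3); (0, 4); (1, 2); (1, 3); (1, 4); (2, 3); (2, 4); (3, 4)].

(* a, b, c, d, u, w = 0, 1, 2, 3, 4, 5 *)
Definition B8_edges : seq (nat * nat) :=
  [:: (0, 1); (0, 4); (0, 5); (1, 4); (1, 5); (4, 5); (2, 4); (2, 5); (2, 3)].

Definition B8 := edge_list_graph 6 B8_edges.

Definition B9 := edge_list_graph 6 [:: (3, 4), (3, 5) & B8_edges].

Definition beineke (i : 'I_9) : graph :=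
  nth B1 [:: B1; B2; B3; B4; B5; B6; B7; B8; B9] i.

Definition cylinder (a : nat -> bool) (n : nat) : set (nat -> bool) :=
  [set b | forall k, (k < n)%N -> a k = b k].

Section CantorMetric.
Variable R : realType.
Local Open Scope ring_scope.

Definition cantor_metric : Type := nat -> bool.

HB.instance Definition _ := Choice.on cantor_metric.

Implicit Types a b c : cantor_metric.

Lemma cantor_dist_ex a b : exists d : R,
  (a = b /\ d = 0) \/
  (exists m, [/\ d = 2 ^- m, a m <> b m & cylinder a m b]).
Proof.
have [ab|nab] := pselect (a = b); first by exists 0; left.
have H : exists m, a m != b m.
  apply: contrapT => nH; apply: nab; apply/funext => m.
  by apply/eqP; apply: contrapT => /negP abm; apply: nH; exists m.
exists (2 ^- ex_minn H); right; exists (ex_minn H).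
case: ex_minnP => m abm mmin; split => //; first exact/eqP.
move=> k km; apply/eqP; apply: contraTT km => abk.
by rewrite -leqNgt; exact: mmin.
Qed.

Definition cantor_dist a b : R := sval (cid (cantor_dist_ex a b)).

Lemma cantor_distP a b (n : nat) :
  cantor_dist a b <= 2 ^- n <-> cylinder a n b.
Proof.
rewrite /cantor_dist; case: cid => d /= [[-> ->]|[m [-> abm abk]]].
  by split => // _; rewrite invr_ge0 exprn_ge0.
rewrite lef_pV2 ?posrE ?exprn_gt0// ler_eXn2l ?ltr1n//; split.
  by move=> nm k kn; apply: abk; exact: leq_trans nm.
by move=> abn; rewrite leqNgt; apply/negP => /abn.
Qed.

Lemma cantor_dist_val a b :
  cantor_dist a b = 0 \/ exists m, cantor_dist a b = 2 ^- m.
Proof.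
rewrite {1 2}/cantor_dist; case: cid => d /= [[_ ->]|[m [-> _ _]]]; first by left.
by right; exists m.
Qed.

Lemma cantor_dist_ge0 a b : 0 <= cantor_dist a b.
Proof.
by have [->//|[m ->]] := cantor_dist_val a b; rewrite invr_ge0 exprn_ge0.
Qed.

Lemma cantor_dist_eq0 a b : cantor_dist a b = 0 <-> a = b.
Proof.
split=> [ab0|->].
  apply/funext => k; have : cantor_dist a b <= 2 ^- k.+1.
    by rewrite ab0 invr_ge0 exprn_ge0.
  by move=> /cantor_distP; apply.
rewrite /cantor_dist; case: cid => d /= [[_ ->]//|[m [_]]].
by move=> /(_ erefl).
Qed.

Lemma cantor_dist_le a b c a' b' : 
  (forall n, cylinder a n b -> cylinder a' n b') ->
  cantor_dist a' b' <= cantor_dist a b.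
Proof.
move=> H; have [ab0|[m abm]] := cantor_dist_val a b; last first.
  by rewrite abm; apply/cantor_distP/H/cantor_distP; rewrite abm.
suff -> : a' = b' by rewrite (cantor_dist_eq0 b' b').2 ?cantor_dist_ge0.
apply/funext => k; apply: (H k.+1) => //.
by apply/cantor_distP; rewrite ab0 invr_ge0 exprn_ge0.
Qed.

Lemma cantor_dist_xx a : cantor_dist a a = 0.
Proof. exact/cantor_dist_eq0. Qed.

Lemma cantor_dist_pos a b : cantor_dist a b = 0 -> a = b.
Proof. by move/cantor_dist_eq0. Qed.

Lemma cantor_dist_sym a b : cantor_dist a b = cantor_dist b a.
Proof.
by apply/eqP; rewrite eq_le; apply/andP; split;
  apply: cantor_dist_le => // n ab k /ab.
Qed.

Lemma cantor_dist_triangle b a c :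
  cantor_dist a c <= cantor_dist a b + cantor_dist b c.
Proof.
suff : cantor_dist a c <= Num.max (cantor_dist a b) (cantor_dist b c).
  move=> /le_trans; apply; rewrite ge_max lerDl lerDr.
  by rewrite !cantor_dist_ge0.
have [abc|cba] := leP (cantor_dist a b) (cantor_dist b c).
  apply: cantor_dist_le => // n bc k kn; rewrite -bc//.
  have /cantor_distP -> // : cantor_dist a b <= 2 ^- n.
  by apply: le_trans abc _; exact/cantor_distP.
apply: cantor_dist_le => // n ab k kn; rewrite ab//.
have /cantor_distP -> // : cantor_dist b c <= 2 ^- n.
by apply: le_trans (ltW cba) _; exact/cantor_distP.
Qed.

HB.instance Definition _ := isMetric.Build R cantor_metric
  cantor_dist_xx cantor_dist_pos cantor_dist_sym cantor_dist_triangle.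

Lemma exp2V_small (e : R) : 0 < e -> exists n, 2 ^- n < e.
Proof.
move=> e0; have [n] := ltr_add_invr (y := 0) (x := e) e0; rewrite add0r => ne.
exists n.+1; apply: lt_trans ne.
by rewrite ltf_pV2 ?posrE ?exprn_gt0 ?ltr0n// -natrX ltr_nat ltn_expl.
Qed.

Lemma cantor_metric_ball a (e : R) : ball a e = [set b | cantor_dist a b < e].
Proof. by rewrite ballEmdist. Qed.

Lemma cantor_metric_nbhs a (A : set cantor_metric) :
  nbhs a A <-> exists n, cylinder a n `<=` A.
Proof.
split=> [/nbhs_ballP[e /= e0]|[n nA]]; rewrite ?cantor_metric_ball.
  move=> eA; have [n ne] := exp2V_small e0; exists n => b /cantor_distP ab.
  by apply: eA; exact: le_lt_trans ne.
apply/nbhs_ballP; exists (2 ^- n) => /=; first by rewrite invr_gt0 exprn_gt0.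
by rewrite cantor_metric_ball => b /= /ltW/cantor_distP/nA.
Qed.

Lemma cantor_space_nbhs (a : cantor_space) (A : set cantor_space) :
  nbhs a A <-> exists n, cylinder a n `<=` A.
Proof.
split=> [|[n nA]]; last first.
  apply: filterS nA _; elim: n => [|n IHn]; first exact: filterS filterT.
  have an : nbhs a (proj (T := fun=> bool) n @^-1` [set a n]).
    by apply: (@proj_continuous nat (fun=> bool) n a); exact: discrete_set1.
  apply: filterS (filterI IHn an) => b [/= ab bn] k.
  by rewrite ltnS leq_eqVlt => /predU1P[->//|]; exact: ab.
pose F : set_system cantor_space := [set A | exists n, cylinder a n `<=` A].
suff : F --> a by apply.
have FF : Filter F.
  split.
  - by exists 0.
  - move=> B C [n nB] [m mC]; exists (maxn n m) => b ab; split.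
      by apply: nB => k kn; apply: ab; rewrite leq_max kn.
    by apply: mC => k km; apply: ab; rewrite leq_max km orbT.
  - by move=> B C BC [n nB]; exists n; exact: subset_trans BC.
apply/cvg_sup => i U [/= _ [[V oV <-] /= Va] VU].
by exists i.+1 => b /= ab; apply: VU => /=; rewrite -ab.
Qed.

Lemma cantor_metric_open :
  @open cantor_metric = @open cantor_space.
Proof.
apply/funext => A; apply/propext; rewrite !openE; split => oA a /oA.
  by move=> /cantor_metric_nbhs aA; apply/cantor_space_nbhs.
by move=> /cantor_space_nbhs aA; apply/cantor_metric_nbhs.
Qed.

Lemma cantor_metric_separable_complete :
  separable_complete (cantor_metric : metricType R).
Proof.
split.
  pose g (s : seq bool) : cantor_metric := nth false s.
  exists (range g); first exact: card_le_trans (card_image_le _ _) (countableP _).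
  move=> O [a Oa] oO; have : nbhs a O by exact: open_nbhs_nbhs.
  move=> /cantor_metric_nbhs[n nO]; exists (g (mkseq a n)); split; last by exists (mkseq a n).
  by apply: nO => k kn; rewrite /g nth_mkseq.
move=> F PF cF.
have cyl n : exists a, F (cylinder a n).
  have e0 : 0 < 2 ^- n :> R by rewrite invr_gt0 exprn_gt0.
  have [a aF] := (cauchyP F).1 cF _ e0.
  exists a; apply: filterS aF => b.
  by rewrite cantor_metric_ball/= => /ltW/cantor_distP.
pose s n := sval (cid (cyl n)).
have sF n : F (cylinder (s n) n) by exact: svalP (cid (cyl n)).
pose p : cantor_metric := fun k => s k.+1 k.
exists p => A /cantor_metric_nbhs [n nA].
apply: filterS nA _.
elim: n => [|n IHn]; first exact: filterS filterT.
apply: filterS (filterI IHn (sF n.+1)) => b [pb sb] k.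
rewrite ltnS leq_eqVlt => /predU1P[->|]; last exact: pb.
by rewrite /p sb.
Qed.

Lemma cantor_standard_borel : standard_borel R (vspace K0).
Proof.
exists (cantor_metric : metricType R), (id : cantor_space -> cantor_metric); split.
- exact: cantor_metric_separable_complete.
- by exists id.
- rewrite cantor_metric_open; apply/seteqP; split => A; first by exists A.
  by move=> [B ? <-].
Qed.

Lemma K0_borel_graph : borel_graph R K0.
Proof.
split; first exact: cantor_standard_borel.
pose X := vspace K0.
pose P := prod_borel (X := X) (Y := X).
have PS : sigma_algebra setT P by exact: (@smallest_sigma_algebra (X * X)%type setT _).
have PR A B : borel X A -> borel X B -> P (A `*` B).
  by move=> bA bB; apply: sub_sigma_algebra; exists A => //; exists B.
rewrite -/P; clearbody P.
have [P0 PD PU] := PS.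
have PC A : P A -> P (~` A) by rewrite -setTD; exact: PD.
have PI (F : (set (cantor_space * cantor_space))^nat) :
    (forall n, P (F n)) -> P (\bigcap_n F n).
  by move=> PF; rewrite -(setCK (\bigcap_n F n)) setC_bigcap; apply/PC/PU => n; exact: PC.
have PU2 A B : P A -> P B -> P (A `|` B).
  by move=> PA PB; rewrite -bigcup2E; apply: PU => -[//|[//|/= _]].
have bC k (c : bool) : borel X [set a : cantor_space | a k = c].
  apply: sub_sigma_algebra; rewrite openE => a /= <-.
  by apply/cantor_space_nbhs; exists k.+1 => b /(_ k) ->.
pose E k : set (cantor_space * cantor_space) := [set ab | ab.1 k = ab.2 k].
have PE k : P (E k).
  have -> : E k = ([set a : cantor_space | a k = true] `*` [set a : cantor_space | a k = true]) `|`
     ([set a : cantor_space | a k = false] `*` [set a : cantor_space | a k = false]).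
    apply/seteqP; split => -[a b] /=; rewrite /E/=.
      by move=> ->; case: (b k); [left|right].
    by move=> [[-> ->]|[-> ->]].
  by apply: PU2; apply: PR; exact: bC.
pose T m k := if (m <= k)%N then E k else setT.
have -> : [set xy : K0 * K0 | adj xy.1 xy.2] =
    ~` (\bigcap_k E k) `&` \bigcup_m \bigcap_k T m k.
  apply/seteqP; split => -[a b] /=.
    move=> [ab [m abm]]; split.
      by move=> abk; apply: ab; apply/funext => k; exact: (abk k).
    by exists m => // k _; rewrite /T; case: ifPn => // /abm.
  move=> [ab [m _ abm]]; split.
    by move=> abE; apply: ab => k _; rewrite /E/= abE.
  by exists m => k mk; have := abm k I; rewrite /T mk.
rewrite -(setCK (_ `&` _)) setCI setCK; apply: (PC); apply: (PU2); first exact: (PI).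
apply: (PC); apply: (PU) => m; apply: (PI) => k; rewrite /T; case: ifP => _ //.
by rewrite -setC0; exact: PC.
Qed.

End CantorMetric.

(* Main.v *)
From HB Require Import structures.
Require Import Defs.
From mathcomp Require Import all_boot all_order all_algebra.
From mathcomp Require Import all_classical all_reals all_analysis.

(** Code the vertices of [L] as points of the Baire space.  By the dichotomy of
    Kechris, Solecki and Todorcevic, proved here by Miller's classical argument,
    an analytic graph either is covered by countably many Borel independent sets
    or receives a continuous homomorphism from [G_0].  Only the claw [B1] and
    [K_5] minus an edge [B7] are needed.  Without [B7], being jointly contained
    in a clique is an equivalence relation on 9-cliques, and without [B1] at most
    two of its classes pass near_clique a given vertex.

    Join two 9-cliques when they are equivalent and have distinct first vertices.
    If this graph on cliques has a countable Borel cover by independent sets, the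
    vertices can be sorted by the colours of their cliques into countably many
    analytic pieces on which [L] is locally finite, and then [L] is countably
    colourable.  Otherwise there is a continuous homomorphism from [G_0]; as [G_0]
    generates [E_0], all the first vertices along an [E_0]-class are equal or
    adjacent.  Local countability makes adjacency meager on pairs of points of
    the Cantor space (Kuratowski--Ulam), and a Cantor scheme of generic pairs
    yields a Borel copy of [K_0]. *)

Set Implicit Arguments.
Unset Strict Implicit.
Unset Printing Implicit Defensive.
Import Order.TTheory GRing.Theory Num.Theory.
Local Open Scope classical_set_scope.
Local Open Scope card_scope.

(** * Borel and analytic subsets of the Baire space *)

(** A homomorphism from $G_0$ into $L$ itself would control only the edges of $G_0$, since adjacency
    is not transitive. Equivalence of cliques is transitive, so there the edges of $G_0$ propagate
    to all of $E_0$. The clause on first vertices serves both alternatives: within one class, an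
    independent set contains only cliques with the same first vertex, and along a homomorphism the
    first vertex is constant on no cylinder. Cliques are the only obstruction to local finiteness
    because, in a claw-free graph, neighbours that accumulate at a vertex contain arbitrarily large
    cliques, by a Ramsey argument. Local finiteness is used in a topological form: no vertex of the
    piece is an accumulation point of its neighbours there. A generic point of a $G_0$-homomorphism
    violates this, so the dichotomy is applied a second time, to the pieces. The vertex codes are
    only shown to form an analytic set, so adjacency is kept as a Borel set restricted to it; this
    makes non-adjacency of vertices analytic too. *)

Definition baire := nat -> nat.

Definition agree (T : Type) (n : nat) (a b : nat -> T) :=
  forall k, k < n -> a k = b k.

Lemma agree_sym (T : Type) n (a b : nat -> T) : agree n a b -> agree n b a.
Proof. by move=> ab k /ab. Qed.

Lemma agree_trans (T : Type) n (b a c : nat -> T) :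
  agree n a b -> agree n b c -> agree n a c.
Proof. by move=> ab bc k kn; rewrite ab// bc. Qed.

Lemma agreeW (T : Type) m n (a b : nat -> T) : m <= n -> agree n a b -> agree m a b.
Proof. by move=> mn ab k km; apply: ab; exact: leq_trans mn. Qed.

Lemma agree_eq (T : Type) (a b : nat -> T) : (forall n, agree n a b) -> a = b.
Proof. by move=> ab; apply/funext => k; exact: (ab k.+1). Qed.

Definition cont (A B : Type) (f : (nat -> A) -> nat -> B) :=
  forall a k, exists m, forall b, agree m a b -> f a k = f b k.

Lemma cont_agree (A B : Type) (f : (nat -> A) -> nat -> B) : cont f ->
  forall a n, exists m, forall b, agree m a b -> agree n (f a) (f b).
Proof.
move=> cf a; elim=> [|n [m IH]]; first by exists 0.
have [m' H] := cf a n; exists (maxn m m') => b ab k.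
rewrite ltnS leq_eqVlt => /predU1P[->|].
  by apply: H; apply: agreeW ab; exact: leq_maxr.
by apply: IH; apply: agreeW ab; exact: leq_maxl.
Qed.

Lemma cont_comp (A B D : Type) (f : (nat -> A) -> nat -> B)
    (g : (nat -> B) -> nat -> D) : cont f -> cont g -> cont (fun a => g (f a)).
Proof.
move=> cf cg a k; have [m mP] := cg (f a) k.
by have [n nP] := cont_agree cf a m; exists n => b /nP/mP.
Qed.

Section Packing.
Variable I : countType.

(** Countably many points of the Baire space are stored in one: index type [bool] gives pairs,
    ['I_9] tuples of vertices, and [seq bool] labelled trees. *)
Definition slice (i : I) (z : baire) : baire := fun n => z (pickle (i, n)).

Definition pack (f : I -> baire) : baire :=
  fun m => if @unpickle (I * nat)%type m is Some (i, n) then f i n else 0.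

Lemma slice_pack f i : slice i (pack f) = f i.
Proof. by apply/funext => n; rewrite /slice /pack pickleK. Qed.

Lemma cont_slice i : cont (slice i).
Proof. by move=> a k; exists (pickle (i, k)).+1 => b; apply. Qed.

Lemma cont_pack (A : Type) (f : I -> (nat -> A) -> baire) :
  (forall i, cont (f i)) -> cont (fun a => pack (fun i => f i a)).
Proof.
move=> cf a k; rewrite /pack; case: unpickle => [[i n]|]; last by exists 0.
exact: cf.
Qed.

(** The first [n] coordinates of a packed family read finitely many entries, whence a modulus that
    does not depend on the families. *)
Lemma agree_pack n : exists m, forall f g : I -> baire,
  (forall i, agree m (f i) (g i)) -> agree n (pack f) (pack g).
Proof.
elim: n => [|n [m IH]]; first by exists 0.
have [m' H] : exists m', forall f g : I -> baire,
    (forall i, agree m' (f i) (g i)) -> pack f n = pack g n.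
  rewrite /pack; case: unpickle => [[i k]|]; last by exists 0.
  by exists k.+1 => f g /(_ i); apply.
exists (maxn m m') => f g fg k; rewrite ltnS leq_eqVlt => /predU1P[->|].
  by apply: H => i; apply: agreeW (fg i); exact: leq_maxr.
by apply: IH => i; apply: agreeW (fg i); exact: leq_maxl.
Qed.

End Packing.

Definition interleave (a b : baire) : baire := pack (fun i : bool => if i then b else a).

Lemma interleave1 a b : slice false (interleave a b) = a. Proof. exact: slice_pack. Qed.
Lemma interleave2 a b : slice true (interleave a b) = b. Proof. exact: slice_pack. Qed.

Lemma cont_interleave (A : Type) (f g : (nat -> A) -> baire) :
  cont f -> cont g -> cont (fun a => interleave (f a) (g a)).
Proof.
move=> cf cg.
have -> : (fun a => interleave (f a) (g a)) =
    fun a => pack (fun i : bool => (if i then g else f) a).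
  by apply/funext => a; congr (pack _); apply/funext => -[].
by apply: cont_pack => -[].
Qed.

Definition closed_baire (D : set baire) :=
  forall z, (forall n, exists2 y, agree n z y & D y) -> D z.

Lemma closed_interleave D a b : closed_baire D ->
  (forall n, exists c d, [/\ agree n a c, agree n b d & D (interleave c d)]) ->
    D (interleave a b).
Proof.
move=> cD H; apply: cD => n; have [m mP] := agree_pack bool n.
have [c [d [ac bd Dcd]]] := H m; exists (interleave c d) => //.
by apply: mP => -[].
Qed.

Lemma closed_preimage f D : cont f -> closed_baire D -> closed_baire (f @^-1` D).
Proof.
move=> cf cD z zD; apply: cD => n; have [m mP] := cont_agree cf z n.
by have [y zy Dy] := zD m; exists (f y) => //; exact: mP.
Qed.

Definition analytic (A : set baire) :=
  exists2 D, closed_baire D & forall s, A s <-> exists b, D (interleave b s).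

Lemma analytic_preimage f A : cont f -> analytic A -> analytic (f @^-1` A).
Proof.
move=> cf [D cD DA].
exists (fun z => D (interleave (slice false z) (f (slice true z)))).
  apply: (@closed_preimage (fun z => interleave (slice false z) (f (slice true z))))
    => //.
  by apply: cont_interleave; [|apply: cont_comp => //]; exact: cont_slice.
move=> s; split=> [/DA[b Db]|[b]]; first by exists b; rewrite interleave1 interleave2.
by rewrite interleave1 interleave2 => Db; apply/DA; exists b.
Qed.

Lemma closed_analytic D : closed_baire D -> analytic D.
Proof.
move=> cD; exists (fun z => D (slice true z)).
  by apply: (@closed_preimage (slice true)) => //; exact: cont_slice.
move=> s; split=> [|[b]]; last by rewrite interleave2.
by exists s; rewrite interleave2.
Qed.

Lemma analytic_ex A : analytic A -> analytic [set s | exists t, A (interleave t s)].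
Proof.
move=> [D cD DA].
exists (fun z => D (interleave (slice false (slice false z)) (interleave (slice true
  (slice false z)) (slice true z)))).
  apply: (@closed_preimage
    (fun z => interleave (slice false (slice false z)) (interleave (slice true (slice
      false z)) (slice true z)))) => //.
  have cs := @cont_slice bool.
  by apply: cont_interleave; [|apply: cont_interleave => //];
    apply: (@cont_comp _ _ _ (slice false)).
move=> s; split=> [[t /DA[b Db]]|[b]].
  by exists (interleave b t); rewrite !(interleave1, interleave2).
by rewrite !(interleave1, interleave2) => Db; exists (slice true b); apply/DA;
  exists (slice false b).
Qed.

Lemma analytic_forall (I : countType) (A : I -> set baire) :
  (forall i, analytic (A i)) -> analytic [set s | forall i, A i s].
Proof.
move=> /= H; have {}H i : exists D, closed_baire D /\ forall s, A i s <-> exists b,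
  D (interleave b s).
  by have [D cD DA] := H i; exists D.
have [D DP] := choice H.
exists (fun z => forall i, D i (interleave (slice i (slice false z)) (slice true z))).
  move=> z zD i.
  apply: (@closed_preimage (fun z => interleave (slice i (slice false z)) (slice true
    z)) (D i)).
  - apply: cont_interleave; last exact: cont_slice.
    by apply: (@cont_comp _ _ _ (slice false)); exact: cont_slice.
  - by have [] := DP i.
  - by move=> n; have [y zy Dy] := zD n; exists y => //; exact: Dy.
move=> s; split=> [Hs|[b Db] i].
  have {}Hs i : exists b, D i (interleave b s) by apply/(DP i).2/Hs.
  have [b bP] := choice Hs; exists (pack b) => i.
  by rewrite interleave1 interleave2 slice_pack.
by apply/(DP i).2; exists (slice i b); have := Db i; rewrite interleave1 interleave2.
Qed.

Lemma analytic_exists (I : countType) (A : I -> set baire) :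
  (forall i, analytic (A i)) -> analytic [set s | exists i, A i s].
Proof.
move=> /= H; have {}H i : exists D, closed_baire D /\ forall s, A i s <-> exists b,
  D (interleave b s).
  by have [D cD DA] := H i; exists D.
have [D DP] := choice H.
(* the first coordinate of the witness names the piece *)
exists (fun z => if @unpickle I (slice false z 0) is Some i
  then D i (interleave (fun n => slice false z n.+1) (slice true z)) else False).
  move=> z zD.
  have [m0 m0P] := cont_slice false z 0.
  have key y : agree m0 z y -> slice false y 0 = slice false z 0 by move=> /m0P.
  move Ei : (unpickle (slice false z 0)) => [i|]; last first.
    by have [y /key zy] := zD m0; rewrite zy Ei.
  apply: (@closed_preimage (fun z => interleave (fun n =>
    slice false z n.+1) (slice true z)) (D i)).
  - apply: cont_interleave; last exact: cont_slice.
    by move=> a k; exact: cont_slice.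
  - by have [] := DP i.
  - move=> n; have [y zy Dy] := zD (maxn m0 n); exists y.
      by apply: agreeW zy; exact: leq_maxr.
    by move: Dy; rewrite key ?Ei//; apply: agreeW zy; exact: leq_maxl.
move=> s; split=> [[i /(DP i).2[b Db]]|[b]].
  exists (fun n => if n is n'.+1 then b n' else pickle i).
  by rewrite interleave1 interleave2 pickleK.
rewrite interleave1 interleave2; case: unpickle => // i Db; exists i; apply/(DP i).2.
by exists (fun n => b n.+1).
Qed.

Lemma analyticI A B : analytic A -> analytic B -> analytic (A `&` B).
Proof.
move=> aA aB.
have -> : A `&` B = [set s | forall i : bool, (if i then A else B) s].
  apply/seteqP; split=> s /= => [[? ?] []|H] //.
  by split; [exact: (H true)|exact: (H false)].
by apply: analytic_forall => -[].
Qed.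

Lemma analytic_cst (P : Prop) : analytic [set _ | P].
Proof. by apply: closed_analytic => z zP; have [y _ ?] := zP 0. Qed.

Lemma analytic_imp (P : Prop) A : analytic A -> analytic [set s | P -> A s].
Proof.
have [p|np] := pselect P => aA.
  by have -> : [set s | P -> A s] = A by apply/seteqP; split=> s /=; auto.
have -> : [set s | P -> A s] = [set _ | True] by apply/seteqP; split=> s /= _ // /np.
exact: analytic_cst.
Qed.

Inductive borel_baire : set baire -> Prop :=
| borel_baire_gen k m : borel_baire [set s | s k = m]
| borel_baireC A : borel_baire A -> borel_baire (~` A)
| borel_baire_bigcup (F : nat -> set baire) :
    (forall n, borel_baire (F n)) -> borel_baire [set s | exists n, F n s].

Lemma borel_baire_exists (I : countType) (F : I -> set baire) :
  (forall i, borel_baire (F i)) -> borel_baire [set s | exists i, F i s].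
Proof.
move=> bF.
pose A := [set s : baire | s 0 = 0]; have bA : borel_baire A by exact: borel_baire_gen.
(* No generator is empty; the empty set arises as the complement of the union of [A] and its
   complement. *)
have b0 : borel_baire set0.
  have -> : set0 = ~` [set s | exists n : nat, (if n is 0 then A else ~` A) s].
    rewrite -[LHS]setCK; congr (~` _); rewrite setC0; apply/seteqP; split=> // s _ /=.
    by have [?|?] := pselect (A s); [exists 0|exists 1].
  by apply/borel_baireC/borel_baire_bigcup => -[|n] //; exact: borel_baireC.
have -> : [set s | exists i, F i s] =
    [set s | exists n, (if @unpickle I n is Some i then F i else set0) s].
  apply/seteqP; split=> s /= => [[i Fi]|[n]].
    by exists (pickle i); rewrite pickleK.
  by case: unpickle => // i Fi; exists i.
by apply: borel_baire_bigcup => n; case: unpickle.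
Qed.

Lemma borel_baire_forall (I : countType) (F : I -> set baire) :
  (forall i, borel_baire (F i)) -> borel_baire [set s | forall i, F i s].
Proof.
move=> bF; have -> : [set s | forall i, F i s] = ~` [set s | exists i, (~` F i) s].
  apply/seteqP; split=> s /= => [Fs [i]|Fs i]; first by apply.
  by apply: contrapT => nF; apply: Fs; exists i.
by apply/borel_baireC/borel_baire_exists => i; exact: borel_baireC.
Qed.

Lemma borel_baireU A B : borel_baire A -> borel_baire B -> borel_baire (A `|` B).
Proof.
move=> bA bB; have -> : A `|` B = [set s | exists i : bool, (if i then A else B) s].
  by apply/seteqP; split=> s /= => [[?|?]|[[] ?]]; [exists true|exists false|left|right].
by apply: borel_baire_exists => -[].
Qed.

Lemma borel_baireI A B : borel_baire A -> borel_baire B -> borel_baire (A `&` B).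
Proof.
move=> bA bB; have -> : A `&` B = [set s | forall i : bool, (if i then A else B) s].
  apply/seteqP; split=> s /= => [[? ?] []|H'] //.
  by split; [exact: (H' true)|exact: (H' false)].
by apply: borel_baire_forall => -[].
Qed.

Lemma borel_baire_cst (P : Prop) : borel_baire [set _ | P].
Proof.
have b0 : borel_baire [set s | s 0 = 0] by exact: borel_baire_gen.
have bT : borel_baire setT by rewrite -(setUv [set s : baire | s 0 = 0]);
  exact/borel_baireU/borel_baireC.
have [p|np] := pselect P.
  by have -> : [set _ : baire | P] = setT by apply/seteqP; split.
have -> : [set _ : baire | P] = ~` setT; last exact: borel_baireC.
by rewrite setCT; apply/seteqP; split.
Qed.

Lemma borel_baire_preimage f A : cont f -> borel_baire A -> borel_baire (f @^-1` A).
Proof.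
move=> cf; elim=> [k m|B _ IH|F _ IH]; last 2 first.
- exact: borel_baireC IH.
- exact: (borel_baire_bigcup IH).
(* each f s k is decided by a prefix of s *)
have -> : f @^-1` [set s | s k = m] =
    [set s : baire | exists u : seq nat, (forall i : 'I_(size u), s i = nth 0 u i) /\
      (forall t : baire, (forall i : 'I_(size u), t i = nth 0 u i) -> f t k = m)].
  apply/seteqP; split=> s /=.
    move=> fs; have [n nP] := cf s k; exists (mkseq s n); split.
      by move=> [i]; rewrite size_mkseq => im; rewrite nth_mkseq.
    move=> t tP; rewrite -nP// => i im.
    have im' : i < size (mkseq s n) by rewrite size_mkseq.
    by rewrite (tP (Ordinal im')) nth_mkseq.
  by move=> [u [su]]; apply.
apply: borel_baire_exists => u; apply: borel_baireI; last exact: borel_baire_cst.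
by apply: borel_baire_forall => i; exact: borel_baire_gen.
Qed.

(** The induction carries the complement along, since analytic sets need not be closed under
    complements. *)
Lemma borel_analytic A : borel_baire A -> analytic A.
Proof.
suff : borel_baire A -> analytic A /\ analytic (~` A) by move=> /[apply] -[].
elim=> [k m|B _ [IH1 IH2]|F _ IH].
- by split; apply: closed_analytic => z zP; have [y zy] := zP k.+1; rewrite /= (zy k).
- by rewrite setCK.
- split; first by apply: analytic_exists => n; have [] := IH n.
  have -> : ~` [set s | exists n, F n s] = [set s | forall n, (~` F n) s].
    by apply/seteqP; split=> s /= => [H n Fn|H [n]]; [apply: H; exists n|exact: H].
  by apply: analytic_forall => n; have [] := IH n.
Qed.

(** * Separation *)

Lemma dependent_choice_nat (X : Type) (P : nat -> X -> Prop) (R : nat -> X -> X ->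
  Prop) x0 :
  P 0 x0 -> (forall n x, P n x -> exists2 y, P n.+1 y & R n x y) ->
  exists f : nat -> X, [/\ f 0 = x0, forall n, P n (f n) & forall n, R n (f n) (f n.+1)].
Proof.
move=> P0 H.
have /choice[g gP] (p : nat * X) : exists y, P p.1 p.2 -> P p.1.+1 y /\ R p.1 p.2 y.
  have [/H[y ? ?]|?] := pselect (P p.1 p.2); first by exists y.
  by exists p.2.
pose f := fix f n := if n is n'.+1 then g (n', f n') else x0.
have Pf n : P n (f n) by elim: n => // n /(gP (n, f n))[].
by exists f; split=> // n; have [] := gP (n, f n) (Pf n).
Qed.

(** Coordinate [i] is read from term [i.+1], the first term in which it is final when term [n] fixes
    the coordinates below [n]. *)
Definition diag_lim (T : Type) (f : nat -> nat -> T) : nat -> T := fun i => f i.+1 i.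

Lemma diag_limP (T : Type) (f : nat -> nat -> T) n :
  (forall n, agree n (f n) (f n.+1)) -> agree n (f n) (diag_lim f).
Proof.
move=> fP k kn; rewrite /diag_lim.
have H d : agree k.+1 (f k.+1) (f (k.+1 + d)).
  elim: d => [|d IH]; first by rewrite addn0.
  apply: agree_trans IH _; rewrite addnS; apply: agreeW (fP _).
  by rewrite leq_addr.
by rewrite -(subnKC kn) -H.
Qed.

Definition separable (P Q : set baire) :=
  exists2 C, borel_baire C & P `<=` C /\ Q `<=` ~` C.

Lemma separable_bigcup (I J : countType) (F : I -> set baire) (H : J -> set baire) P Q :
  P `<=` [set s | exists i, F i s] -> Q `<=` [set s | exists j, H j s] ->
  (forall i j, separable (F i) (H j)) -> separable P Q.
Proof.
move=> PF QH sFH.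
have /choice[C CP] (p : I * J) :
    exists C, [/\ borel_baire C, F p.1 `<=` C & H p.2 `<=` ~` C].
  by have [C ? []] := sFH p.1 p.2; exists C.
exists [set s | exists i, forall j, C (i, j) s].
  apply: borel_baire_exists => i; apply: borel_baire_forall => j.
  by have [] := CP (i, j).
split=> s; first by move=> /PF[i Fi]; exists i => j; have [_ + _] := CP (i, j); exact.
by move=> /QH[j Hj] [i /(_ j)]; have [_ _] := CP (i, j); exact.
Qed.

(** Lusin separation. If two pieces are not separable, then neither are some two of their countably
    many refinements, so one descends to limit points [s] and [s']. A coordinate where these differ
    would separate late pieces; if [s = s'], closedness puts the common point in both sets. *)
Lemma analytic_separation A B : analytic A -> analytic B -> A `<=` ~` B -> separable A B.
Proof.
move=> [DA cDA DAP] [DB cDB DBP] AB; apply: contrapT => nsep.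
pose piece (D : set baire) n (x : baire * baire) : set baire :=
  [set t | exists c, [/\ agree n x.1 c, agree n x.2 t & D (interleave c t)]].
(* Only coordinate [n] of the extension matters; the constant values beyond it are filler. *)
pose ext n (x : baire * baire) (i : nat * nat) : baire * baire :=
  (fun k => if k < n then x.1 k else i.1, fun k => if k < n then x.2 k else i.2).
have pieceS D n x : piece D n x `<=` [set t | exists i, piece D n.+1 (ext n x i) t].
  move=> t [c [xc xt Dt]]; exists (c n, t n), c; split=> // k; rewrite ltnS leq_eqVlt /=.
    by move=> /predU1P[->|kn]; rewrite ?ltnn// kn xc.
  by move=> /predU1P[->|kn]; rewrite ?ltnn// kn xt.
pose X := ((baire * baire) * (baire * baire))%type.
pose O : baire := fun _ => 0.
have [|n [x y] nxy|f [_ fP fR]] := @dependent_choice_nat X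
  (fun n z => ~ separable (piece DA n z.1) (piece DB n z.2))
  (fun n z z' => [/\ agree n z.1.1 z'.1.1, agree n z.1.2 z'.1.2,
     agree n z.2.1 z'.2.1 & agree n z.2.2 z'.2.2]) ((O, O), (O, O)).
- move=> [C bC [AC BC]]; apply: nsep; exists C => //; split=> s.
    by move=> /DAP[b Db]; apply: AC; exists b.
  by move=> /DBP[b Db]; apply: BC; exists b.
- have : ~ forall i j, separable (piece DA n.+1 (ext n x i)) (piece DB n.+1 (ext n y j)).
    by move=> H; apply: nxy; exact: separable_bigcup H.
  move=> /existsNP[i /existsNP[j nij]]; exists (ext n x i, ext n y j) => //.
  by split=> k kn /=; rewrite kn.
pose b := diag_lim (fun n => (f n).1.1); pose s := diag_lim (fun n => (f n).1.2).
pose b' := diag_lim (fun n => (f n).2.1); pose s' := diag_lim (fun n => (f n).2.2).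
have bP n : agree n (f n).1.1 b by apply: (@diag_limP _ (fun n => (f n).1.1)) => m;
  have [] := fR m.
have sP n : agree n (f n).1.2 s by apply: (@diag_limP _ (fun n => (f n).1.2)) => m;
  have [] := fR m.
have b'P n : agree n (f n).2.1 b' by apply: (@diag_limP _ (fun n => (f n).2.1)) => m;
  have [] := fR m.
have s'P n : agree n (f n).2.2 s' by apply: (@diag_limP _ (fun n => (f n).2.2)) => m;
  have [] := fR m.
have ss' : s = s'.
  apply/funext => k; apply: contrapT => ks; apply: (fP k.+1).
  exists [set t | t k = s k]; first exact: borel_baire_gen.
  split=> t [c [_ ft _]] /=; first by rewrite -ft// sP.
  by rewrite -ft// s'P// => /esym.
(* An empty piece would be separated by the empty set, so every piece has a member; these members
   converge to the limit, and [DA] is closed. *)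
have [b2 Db2] : exists b, DA (interleave b s).
  exists b; apply: closed_interleave cDA _ => n; apply: contrapT => H; apply: (fP n).
  exists set0; first exact: borel_baire_cst.
  split=> [t [c [bc st Dt]]|t _ []]; case: H; exists c, t; split=> //.
    exact: agree_trans (agree_sym (bP n)) bc.
  exact: agree_trans (agree_sym (sP n)) st.
have [b2' Db2'] : exists b, DB (interleave b s).
  exists b'; apply: (closed_interleave cDB) => m; apply: contrapT => H; apply: (fP m).
  exists setT; first exact: (borel_baire_cst True).
  split=> [t _|t [c [bc st Dt]]]; first by [].
  case: H; exists c, t; split=> //.
    exact: agree_trans (agree_sym (b'P m)) bc.
  by rewrite ss'; exact: agree_trans (agree_sym (s'P m)) st.
have /AB : A s by apply/DAP; exists b2.
by apply; apply/DBP; exists b2'.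
Qed.

Definition independent (G : baire -> baire -> Prop) (A : set baire) :=
  forall x y, A x -> A y -> ~ G x y.

Definition analytic_rel (G : baire -> baire -> Prop) :=
  analytic [set z | G (slice false z) (slice true z)].

Lemma analytic_rel_comp G f g : analytic_rel G -> cont f -> cont g ->
  analytic [set z | G (f z) (g z)].
Proof.
move=> aG cf cg.
have := analytic_preimage (cont_interleave cf cg) aG.
by congr analytic; apply/seteqP; split=> z /=; rewrite interleave1 interleave2.
Qed.

(** Separation is applied twice: [B1] avoids the targets of edges from [A], so no edge leads from
    [A] into [B1]; [B2] then avoids the sources of edges into [B1]. *)
Lemma independent_borel_hull G A : analytic_rel G -> analytic A -> independent G A ->
  exists B, [/\ borel_baire B, independent G B & A `<=` B].
Proof.
move=> aG aA iA.
have c1 := @cont_slice bool false; have c2 := @cont_slice bool true.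
have [B1 bB1 [AB1 B1P]] : separable A [set y | exists x, A x /\ G x y].
  apply: analytic_separation => //; last by move=> y Ay [x [Ax]]; exact: iA.
  have -> : [set y | exists x, A x /\ G x y] =
      [set y | exists x, (slice false @^-1` A `&`
        [set z | G (slice false z) (slice true z)]) (interleave x y)].
    by apply/seteqP; split=> y [x xP]; exists x; move: xP;
      rewrite /= interleave1 interleave2.
  by apply: analytic_ex; apply: analyticI => //; exact: analytic_preimage.
have [B2 bB2 [AB2 B2P]] : separable A [set x | exists y, B1 y /\ G x y].
  apply: analytic_separation => //; last first.
    by move=> x Ax [y [B1y Gxy]]; apply: (B1P y) => //; exists x.
  have -> : [set x | exists y, B1 y /\ G x y] =
      [set x | exists y, (slice false @^-1` B1 `&`
        [set z | G (slice true z) (slice false z)]) (interleave y x)].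
    by apply/seteqP; split=> y [x xP]; exists x; move: xP;
      rewrite /= interleave1 interleave2.
  apply: analytic_ex; apply: analyticI; last exact: analytic_rel_comp.
  by apply: analytic_preimage => //; exact: borel_analytic.
exists (B1 `&` B2); split; first exact: borel_baireI.
  by move=> x y [_ B2x] [B1y _] Gxy; apply: (B2P x) => //; exists y.
by move=> x Ax; split; [exact: AB1|exact: AB2].
Qed.

(** * The G_0 dichotomy *)

Definition cantor := nat -> bool.

Definition prepend (s : seq bool) (a : cantor) : cantor :=
  fun n => if n < size s then nth false s n else a (n - size s).

Lemma prepend_cat s t a : prepend (s ++ t) a = prepend s (prepend t a).
Proof.
apply/funext => n; rewrite /prepend size_cat nth_cat.
case: (ltnP n (size s)) => sn; first by rewrite (leq_trans sn)// leq_addr.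
by rewrite -(ltn_subLR _ sn) subnDA.
Qed.

Lemma prepend_rcons s i a : prepend (rcons s i) a = prepend s (prepend [:: i] a).
Proof. by rewrite -cats1 prepend_cat. Qed.

Definition starts (s : seq bool) (a : cantor) :=
  forall k, k < size s -> nth false s k = a k.

Lemma starts_prepend s a : starts s (prepend s a).
Proof. by move=> k ks; rewrite /prepend ks. Qed.

Lemma startsP s a : starts s a <-> a = prepend s (fun n => a (size s + n)).
Proof.
split=> [sa|->]; last exact: starts_prepend.
apply/funext => n; rewrite /prepend; case: ltnP => [/sa//|sn].
by rewrite subnKC.
Qed.

Lemma starts_mkseq a n : starts (mkseq a n) a.
Proof. by move=> k; rewrite size_mkseq => kn; rewrite nth_mkseq. Qed.

Lemma prepend_mkseq a m : a = prepend (mkseq a m) (fun n => a (m + n)).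
Proof. by have /startsP := @starts_mkseq a m; rewrite size_mkseq. Qed.

Lemma starts_agree a b n : starts (mkseq a n) b <-> agree n a b.
Proof.
split=> H k; first by move=> kn; rewrite -H ?size_mkseq// nth_mkseq.
by rewrite size_mkseq => kn; rewrite nth_mkseq// H.
Qed.

Lemma starts_cat s t a : starts (s ++ t) a -> starts s a.
Proof.
move=> sta k ks; have := sta k; rewrite size_cat nth_cat ks; apply.
by rewrite (leq_trans ks)// leq_addr.
Qed.

Lemma starts_prefix s t a : size s <= size t -> starts s a -> starts t a ->
  exists r, t = s ++ r.
Proof.
move=> st sa ta; exists (drop (size s) t); rewrite -{1}(cat_take_drop (size s) t).
congr (_ ++ _); apply: (@eq_from_nth _ false) => [|k]; rewrite size_takel// => ks.
by rewrite nth_take// sa// ta// (leq_trans ks).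
Qed.

(* [g0_string k] has length [k], and every finite string is a prefix of one of them. *)
Definition g0_string (k : nat) : seq bool :=
  let s := if @unpickle (seq bool * nat)%type k is Some (s, _) then s else [::] in
  take k s ++ nseq (k - size s) false.

Lemma size_g0_string k : size (g0_string k) = k.
Proof.
rewrite /g0_string; set s := (X in take _ X).
rewrite size_cat size_nseq size_take; case: ltnP => [ks|sk]; last by rewrite subnKC.
by rewrite (eqP (ltnW ks : k - size s == 0)) addn0.
Qed.

(** The spare number in the code gives [s] infinitely many codes; one of them is at least [size s],
    and there [take] cuts nothing off. *)
Lemma g0_string_dense s : exists k r, g0_string k = s ++ r.
Proof.
have [m sm] : exists m : nat, size s <= pickle (s, m).
  apply: contrapT => /forallNP H.
  suff : (size s).+1 <= size s by rewrite ltnn.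
  rewrite -{1}(size_iota 0 (size s).+1) -{2}(size_iota 0 (size s)).
  rewrite -(size_map (fun m : nat => pickle (s, m))).
  apply: uniq_leq_size; first by rewrite map_inj_uniq ?iota_uniq// =>
    m m' /(pcan_inj pickleK)[].
  by move=> _ /mapP[m _ ->]; rewrite mem_iota add0n /= ltnNge; apply/negP/H.
exists (pickle (s, m)), (nseq (pickle (s, m) - size s) false).
by rewrite /g0_string pickleK take_oversize.
Qed.

(* A sigma-ideal; the covering sets themselves, not only their traces on [W], are
   Borel and independent. *)
Definition small (G : baire -> baire -> Prop) (W : set baire) :=
  exists2 B : nat -> set baire, (forall n, borel_baire (B n) /\ independent G (B n)) &
    forall s, W s -> exists n, B n s.

Definition g0_hom (G : baire -> baire -> Prop) (phi : cantor -> baire) :=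
  forall k a, G (phi (prepend (rcons (g0_string k) false) a))
                (phi (prepend (rcons (g0_string k) true) a)).

Lemma small_exists G (I : countType) (W : I -> set baire) :
  (forall i, small G (W i)) -> small G [set s | exists i, W i s].
Proof.
move=> /= H.
have /choice[B BP] (i : I) : exists B : nat -> set baire,
    (forall n, borel_baire (B n) /\ independent G (B n)) /\
    forall s, W i s -> exists n, B n s.
  by have [B ? ?] := H i; exists B.
exists (fun n => if @unpickle (I * nat)%type n is Some (i,
  m) then B i m else [set _ | False]).
  move=> n; case: unpickle => [[i m]|]; first by have [/(_ m)] := BP i.
  by split=> //; exact: borel_baire_cst.
move=> s [i Wis]; have [_ /(_ s Wis)[m Bm]] := BP i.
by exists (pickle (i, m)); rewrite pickleK.
Qed.

Lemma smallU G A B : small G A -> small G B -> small G (A `|` B).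
Proof.
move=> sA sB; have := @small_exists G bool (fun i => if i then A else B).
have -> : [set s | exists i : bool, (if i then A else B) s] = A `|` B.
  by apply/seteqP; split=> s /= => [[[] ?]|[?|?]]; [left|right|exists true|exists false].
by apply=> -[].
Qed.

Lemma smallS G A B : A `<=` B -> small G B -> small G A.
Proof. by move=> AB [F FP BF]; exists F => // s /AB/BF. Qed.

Lemma small_borel G A : small G A -> exists B, [/\ borel_baire B, small G B & A `<=` B].
Proof.
move=> [B BP AB]; exists [set s | exists n, B n s]; split=> //; last by exists B.
by apply: borel_baire_bigcup => n; have [] := BP n.
Qed.

Lemma small_independent G A : analytic_rel G -> analytic A -> independent G A ->
  small G A.
Proof.
move=> aG aA iA; have [B [bB iB AB]] := independent_borel_hull aG aA iA.
by exists (fun=> B) => // s /AB Bs; exists 0.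
Qed.

Lemma analytic_eq (f g : baire -> baire) : cont f -> cont g ->
  analytic [set z | f z = g z].
Proof.
move=> cf cg.
have := @analytic_preimage (fun z => interleave (f z) (g z)) [set z | slice false z =
  slice true z].
have -> : (fun z => interleave (f z) (g z)) @^-1` [set z | slice false z = slice true
  z] = [set z | f z = g z].
  by apply/seteqP; split=> z /=; rewrite interleave1 interleave2.
apply; first exact: cont_interleave.
apply: closed_analytic => z zP; apply/funext => k.
have [m mP] := cont_slice false z k; have [m' m'P] := cont_slice true z k.
have [y zy /= yy] := zP (maxn m m').
rewrite (mP y) ?(m'P y) ?yy//.
  by apply: agreeW zy; exact: leq_maxr.
by apply: agreeW zy; exact: leq_maxl.
Qed.

Lemma analytic_agree n a (f : baire -> baire) : cont f ->
  analytic [set z | agree n a (f z)].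
Proof.
move=> cf; apply: analytic_forall => k; apply: analytic_imp.
apply: (@analytic_preimage f [set s | a k = s k]) => //.
have -> : [set s : baire | a k = s k] = [set s | s k = a k] by apply/seteqP; split.
exact/borel_analytic/borel_baire_gen.
Qed.

Lemma word_bound (f : seq bool -> nat) n : exists N, forall p, size p <= n -> f p < N.
Proof.
elim: n f => [|n IH] f; first by exists (f [::]).+1 => p; rewrite leqn0 => /nilP->.
have [N NP] := IH (fun p => f (true :: p)); have [M MP] := IH (fun p => f (false :: p)).
exists (maxn (f [::]).+1 (maxn N M)) => -[_|[] p pn]; rewrite !leq_max ?leqnn//.
  by rewrite NP ?orbT.
by rewrite MP ?orbT.
Qed.

(** Finite sequences padded with zeros form a countable dense set of labellings of a tree of depth
    [n]. Countability allows [big_step] to treat all candidate refinements at once. *)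
Lemma word_code_dense n (g : seq bool -> baire) :
  exists u : seq nat, forall p, size p <= n -> agree n (g p) (slice p (nth 0 u)).
Proof.
have [N NP] := word_bound (fun p => \max_(i < n) pickle (p, val i)) n.
exists (mkseq (pack g) N) => p pn k kn; rewrite /slice nth_mkseq.
  by rewrite -[RHS]/(slice p (pack g) k) slice_pack.
apply: leq_ltn_trans (NP p pn).
exact: (@leq_bigmax _ (fun i : 'I_n => pickle (p, val i)) (Ordinal kn)).
Qed.

Section G0Dichotomy.
Variable G : baire -> baire -> Prop.
Hypothesis aG : analytic_rel G.
Variable D : set baire.
Hypothesis cD : closed_baire D.
Hypothesis GD : forall x y, G x y <-> exists b, D (interleave b (interleave x y)).

(* A configuration of level n is a complete binary tree of depth n, whose nodes
   are addressed by their paths, read from the last bit to the first.  The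
   leaves carry vertices; an inner node carries a witness of the adjacency of
   two leaves below it. *)
Definition valid n (c : seq bool -> baire) := forall q k, size q + k.+1 = n ->
  D (interleave (c q) (interleave (c (q ++ false :: rev (g0_string k)))
                      (c (q ++ true :: rev (g0_string k))))).

Definition config n (a : seq bool -> baire) (Z : set baire) (c : seq bool -> baire) :=
  [/\ forall p, size p <= n -> agree n (a p) (c p), valid n c &
      forall p, size p = n -> Z (c p)].

(* Miller's derivative is iterated transfinitely; quantifying over all co-small
   Borel sets replaces the iteration. *)
Definition big n a := forall Z, borel_baire Z -> small G (~` Z) -> exists c,
  config n a Z c.

(** If no refinement of [a] were big, intersect the co-small sets [Z u] that refute the countably
    many codes [u]. The vertices at position [g0_string n] of configurations inside the intersection
    form an independent set: an edge between two of them would glue two configurations under a new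
    root into one that some [Z u] excludes. The Borel hull of this set is small, and removing it
    contradicts that [a] is big. *)
Lemma big_step n a : big n a -> exists2 a', big n.+1 a' &
  forall i p, size p <= n -> agree n (a p) (a' (i :: p)).
Proof.
move=> ba; apply: contrapT => H.
have {}H (u : seq nat) : exists Z, [/\ borel_baire Z, small G (~` Z) &
    (forall i p, size p <= n -> agree n (a p) (slice (i :: p) (nth 0 u))) ->
    forall c, ~ config n.+1 (fun p => slice p (nth 0 u)) Z c].
  have [ua|nua] := pselect (forall i p, size p <= n ->
    agree n (a p) (slice (i :: p) (nth 0 u))); last first.
    exists [set _ | True]; split=> //; first exact: borel_baire_cst.
    by exists (fun=> [set _ | False]) => [m|s []//]; split=> //; exact: borel_baire_cst.
  have nb : ~ big n.+1 (fun p => slice p (nth 0 u)) by move=> b; apply: H;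
    exists (fun p => slice p (nth 0 u)).
  move/existsNP: nb => [Z /not_implyP[bZ /not_implyP[sZ nZ]]].
  by exists Z; split=> // _ c cP; apply: nZ; exists c.
have {H}/choice[Z ZP] := H.
pose Z0 := [set s | forall u, Z u s].
have bZ0 : borel_baire Z0 by apply: borel_baire_forall => u; have [] := ZP u.
have sZ0 : small G (~` Z0).
  apply: (@smallS _ _ [set s | exists u, (~` Z u) s]).
    by move=> s nZ; apply: contrapT => nex; apply: nZ => u; apply: contrapT => nZu;
      apply: nex; exists u.
  by apply: small_exists => u; have [] := ZP u.
pose A := [set x | exists c, config n a Z0 c /\ x = c (rev (g0_string n))].
have aA : analytic A.
  have -> : A = [set x | exists g, [set z | config n a Z0 (fun p =>
    slice p (slice false z)) /\
      slice true z = slice (rev (g0_string n)) (slice false z)] (interleave g x)].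
    apply/seteqP; split=> x /= [c].
      move=> [cP xc]; exists (pack c); rewrite interleave1 interleave2 slice_pack;
        split=> //.
      by under eq_fun do rewrite slice_pack.
    by rewrite interleave1 interleave2 => cP; exists (fun p => slice p c).
  have cs p : cont (fun z => slice p (slice false z)).
    by apply: (@cont_comp _ _ _ (slice false)); exact: cont_slice.
  apply: analytic_ex.
  apply: (@analyticI [set z | config n a Z0 (fun p => slice p (slice false z))]);
    last first.
    by apply: analytic_eq => //; exact: cont_slice.
  have -> : [set z | config n a Z0 (fun p => slice p (slice false z))] =
      [set z | forall p, size p <= n -> agree n (a p) (slice p (slice false z))] `&`
      ([set z | valid n (fun p => slice p (slice false z))] `&`
       [set z | forall p : seq bool, size p = n -> Z0 (slice p (slice false z))]).
    by apply/seteqP; split=> z /= => [[? ? ?]|[? []]].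
  apply: analyticI; last apply: analyticI.
  - by apply: analytic_forall => p; apply: analytic_imp; exact: analytic_agree.
  - apply: analytic_forall => q; apply: analytic_forall => k; apply: analytic_imp.
    apply: (@analytic_preimage (fun z => interleave (slice q (slice false z))
      (interleave (slice (q ++ false :: rev (g0_string k)) (slice false z))
            (slice (q ++ true :: rev (g0_string k)) (slice false z)))));
              last exact: closed_analytic.
    by do 2?apply: cont_interleave.
  - apply: analytic_forall => q; apply: analytic_imp.
    by apply: (@analytic_preimage (fun z => slice q (slice false z))) => //;
      exact: borel_analytic.
have iA : independent G A.
  move=> x y [c0 [[ac0 vc0 Zc0] ->]] [c1 [[ac1 vc1 Zc1] ->]] /GD[e De].
  pose c p := if p is i :: p' then (if i then c1 p' else c0 p') else e.
  have [u uP] := word_code_dense n.+1 c.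
  have [_ _ /(_ _ c)] := ZP u; apply.
    move=> i p pn; apply: (@agree_trans _ _ (c (i :: p))).
      by case: i => /=; [exact: ac1|exact: ac0].
    by apply: agreeW (uP (i :: p) pn).
  split=> [p pn||].
  - exact/agree_sym/uP.
  - move=> [|i q] k /=; first by rewrite add0n => -[->].
    by rewrite addSn => -[] qk; case: i; [exact: vc1|exact: vc0].
  - by move=> [|[] p]//= [] pn; [exact: Zc1|exact: Zc0].
have [B [bB iB AB]] := independent_borel_hull aG aA iA.
have [||c cP] := ba (Z0 `\` B).
- by apply: borel_baireI => //; exact: borel_baireC.
- rewrite setDE setCI setCK; apply: smallU => //.
  by exists (fun=> B) => // s; exists 0.
have [ac vc Zc] := cP; have [] : (Z0 `\` B) (c (rev (g0_string n))).
  by apply: Zc; rewrite size_rev size_g0_string.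
move=> _; apply; apply: AB; exists c; split=> //; split=> // p /Zc[] //.
Qed.

(** Iterating [big_step] fixes ever more coordinates of the labels, and the branches of the limit
    tree give the values of the homomorphism. The labels of inner nodes converge as well, to
    witnesses of the edges, because [D] is closed. *)
Lemma g0_dichotomy_closed : small G setT \/ exists2 phi, cont phi & g0_hom G phi.
Proof.
have [?|ns] := pselect (small G setT); [by left|right].
have [|n a ba|f [_ fb fR]] := @dependent_choice_nat _ big
  (fun n a a' => forall i p, size p <= n -> agree n (a p) (a' (i :: p))) (fun _ _ => 0).
(* Level 0 is a single leaf with no adjacency to verify; it exists because the whole space is not
   small. *)
- move=> Z bZ sZ; have [z Zz] : exists z, Z z.
    apply: contrapT => /forallNP nZ; apply: ns; apply: smallS sZ => s _; exact: nZ.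
  by exists (fun=> z); split=> // q k; rewrite addnS.
- by have [a'] := big_step ba; exists a'.
have fT n : exists c, config n (f n) [set _ | True] c.
  apply: fb; first exact: borel_baire_cst.
  by exists (fun=> [set _ | False]) => [m|s []//]; split=> //; exact: borel_baire_cst.
pose branch (a : cantor) n := f n (rev (mkseq a n)).
have branchS a n : agree n (branch a n) (branch a n.+1).
  by rewrite /branch mkseqS rev_rcons; apply: fR; rewrite size_rev size_mkseq.
exists (fun a => diag_lim (branch a)).
  move=> a k; exists k.+1 => b ab; rewrite /diag_lim /branch.
  by congr (f _ (rev _) _); apply/eq_in_map => i; rewrite mem_iota => /andP[_ /ab].
move=> k a; pose pt i : cantor := prepend (rcons (g0_string k) i) a.
have ptE i N : rev (mkseq (pt i) (k.+1 + N)) = rev (mkseq a N) ++ i :: rev (g0_string k).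
  rewrite -[_ :: _]rev_rcons -rev_cat; congr rev.
  apply: (@eq_from_nth _ false) => [|j].
    by rewrite size_cat size_rcons !size_mkseq size_g0_string.
  rewrite size_mkseq => jkN; rewrite nth_mkseq// nth_cat /pt /prepend.
  rewrite size_rcons size_g0_string; case: ltnP => // kj.
  by rewrite nth_mkseq// ltn_subLR.
(* The witness follows the inner nodes that lie exactly [k.+1] levels above the leaves of each
   approximating tree. *)
apply/GD; exists (diag_lim (fun n => f (k.+1 + n) (rev (mkseq a n)))).
apply: (closed_interleave cD) => n; have [m mP] := agree_pack bool n.
pose N := maxn n m; have [c [fc vc _]] := fT (k.+1 + N).
have nN : n <= k.+1 + N by rewrite (leq_trans _ (leq_addl _ _))// leq_maxl.
have mN : m <= k.+1 + N by rewrite (leq_trans _ (leq_addl _ _))// leq_maxr.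
exists (c (rev (mkseq a N))),
  (interleave (c (rev (mkseq (pt false) (k.+1 + N)))) (c (rev (mkseq (pt true) (k.+1 +
    N))))).
split; last by rewrite !ptE; apply: vc; rewrite size_rev size_mkseq addnC.
- apply: (@agree_trans _ _ (f (k.+1 + N) (rev (mkseq a N)))); last first.
    by apply: agreeW (fc _ _) => //; rewrite size_rev size_mkseq leq_addl.
  apply/agree_sym; apply: (@agreeW _ _ N); first exact: leq_maxl.
  apply: (@diag_limP _ (fun n => f (k.+1 + n) (rev (mkseq a n)))) => j.
  rewrite addnS mkseqS rev_rcons; apply: agreeW (fR _ _ _ _); first exact: leq_addl.
  by rewrite size_rev size_mkseq leq_addl.
- have ptP i : agree m (diag_lim (branch (pt i))) (c (rev (mkseq (pt i) (k.+1 + N)))).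
    apply: (@agree_trans _ _ (branch (pt i) (k.+1 + N))).
      by apply/agree_sym; apply: agreeW mN _; apply: diag_limP.
    by apply: agreeW mN _; apply: fc; rewrite size_rev size_mkseq.
  by apply: mP => -[]; exact: ptP.
Qed.

End G0Dichotomy.

Theorem g0_dichotomy G : analytic_rel G ->
  small G setT \/ exists2 phi, cont phi & g0_hom G phi.
Proof.
move=> aG; have [D cD DP] := aG; apply: (g0_dichotomy_closed aG cD) => x y.
by have := DP (interleave x y); rewrite /= interleave1 interleave2.
Qed.

(** * Locally finite graphs and large cliques *)

Lemma string_chain (s : nat -> seq bool) :
  (forall n, exists r, s n.+1 = s n ++ r) -> (forall n, n <= size (s n)) ->
  exists a : cantor, forall n, starts (s n) a.
Proof.
move=> sS sn.
have chain n d : exists r, s (n + d) = s n ++ r.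
  elim: d => [|d [r IH]]; first by exists [::]; rewrite addn0 cats0.
  have [r'] := sS (n + d); rewrite addnS IH -catA => ->; by exists (r ++ r').
exists (fun k => nth false (s k.+1) k) => n k ks.
case: (leqP n k.+1) => nk.
  by have [r] := chain n (k.+1 - n); rewrite subnKC// => ->; rewrite nth_cat ks.
by have [r] := chain k.+1 (n - k.+1); rewrite subnKC 1?ltnW// => ->; rewrite nth_cat sn.
Qed.

(** Baire category below [p]: each [E i] is met along a growing chain of strings. The inserted
    [false] makes every step strictly longer, so that the chain has a limit. *)
Lemma cantor_generic (I : countType) p (E : I -> seq bool -> Prop) :
  (forall i t, exists r, E i (p ++ t ++ r)) ->
  exists2 a : cantor, starts p a & forall i, exists2 s, starts s a & E i s.
Proof.
move=> dE; pose F n s := if @unpickle I n is Some i then E i s else True.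
have dF n t : exists r, F n (p ++ t ++ r).
  by rewrite /F; case: unpickle => [i|]; [exact: dE|exists [::]].
have [|n s [t ->] |s [s0 _ sS]] := @dependent_choice_nat (seq bool)
  (fun _ s => exists t, s = p ++ t)
  (fun n s s' => exists r, s' = s ++ false :: r /\ F n s') p.
- by exists [::]; rewrite cats0.
- have [r Fr] := dF n (rcons t false); exists (p ++ rcons t false ++ r).
    by exists (rcons t false ++ r).
  by exists r; rewrite cat_rcons -catA in Fr *.
have [||a aP] := @string_chain s.
- by move=> n; have [r [-> _]] := sS n; exists (false :: r).
- elim=> // n IH; have [r [-> _]] := sS n.
  by rewrite size_cat /= addnS ltnS (leq_trans IH)// leq_addr.
exists a; first by rewrite -s0; exact: aP.
move=> i; exists (s (pickle i).+1) => //; have [r [_]] := sS (pickle i).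
by rewrite /F pickleK.
Qed.

(** An edge of $G_0$ changes just the bit after [g0_string k], so edges with large [k] move a point
    only slightly. *)
Lemma g0_hom_flip G phi k a : g0_hom G phi -> starts (g0_string k) a ->
  exists2 b, agree k a b & G (phi a) (phi b) \/ G (phi b) (phi a).
Proof.
move=> hG ka; pose t : cantor := fun n => a (k.+1 + n).
have aE : a = prepend (rcons (g0_string k) (a k)) t.
  have /startsP {1}-> : starts (rcons (g0_string k) (a k)) a.
    move=> j; rewrite size_rcons size_g0_string ltnS leq_eqVlt nth_rcons size_g0_string.
    by move=> /predU1P[->|jk]; rewrite ?ltnn ?eqxx// jk ka// size_g0_string.
  by rewrite size_rcons size_g0_string.
exists (prepend (rcons (g0_string k) (~~ a k)) t).
  move=> j jk; rewrite /prepend size_rcons size_g0_string ltnS (ltnW jk).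
  by rewrite nth_rcons size_g0_string jk ka// size_g0_string.
by have := hG k t; case: (a k) aE => /= <-; [right|left].
Qed.

(** Accumulation in the Baire topology. Infinitely many neighbours need not accumulate at their
    vertex, so excluding this asks less than local finiteness. *)
Definition clusters_at (x : baire) (N : set baire) :=
  forall n, exists y, [/\ N y, y <> x & agree n x y].

Lemma clusters_atS x (M N : set baire) : M `<=` N -> clusters_at x M -> clusters_at x N.
Proof. by move=> MN aM n; have [y [My yx xy]] := aM n; exists y; split=> //;
  exact: MN. Qed.

Lemma clusters_atU x (M N : set baire) : clusters_at x (M `|` N) ->
  clusters_at x M \/ clusters_at x N.
Proof.
move=> aMN; have [|nM] := pselect (clusters_at x M); [by left|right=> n].
have [m mP] : exists m, forall y, M y -> y <> x -> ~ agree m x y.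
  move/existsNP: nM => [m mP]; exists m => y My yx xy; apply: mP; by exists y.
have [y [[My|Ny] yx xy]] := aMN (maxn m n).
  by case: (mP y) => //; apply: agreeW xy; exact: leq_maxl.
by exists y; split=> //; apply: agreeW xy; exact: leq_maxr.
Qed.

Lemma clusters_atD1 x y N : clusters_at x N -> clusters_at x [set z | N z /\ z <> y].
Proof.
move=> aN n; have [yx|yx] := pselect (y = x).
  by have [z [Nz zx xz]] := aN n; exists z; split=> //; split=> //; rewrite yx.
have [k xyk] : exists k, x k <> y k.
  by apply: contrapT => /forallNP H; apply: yx; apply/esym/funext => k;
    exact: contrapT (H k).
have [z [Nz zx xz]] := aN (maxn n k.+1); exists z; split=> //.
  by split=> // zy; apply: xyk; rewrite xz ?zy// leq_max ltnSn orbT.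
by apply: agreeW xz; exact: leq_maxl.
Qed.

Lemma clusters_at_nonempty x N : clusters_at x N -> exists y, N y /\ y <> x.
Proof. by move=> /(_ 0)[y []]; exists y. Qed.

Section LocallyFinite.
Variable G : baire -> baire -> Prop.
Hypotheses (aG : analytic_rel G) (symG : forall x y,
  G x y -> G y x) (irrG : forall x, ~ G x x).

(** Otherwise the graph on [W] receives a continuous homomorphism from $G_0$. A generic point of the
    Cantor space starts with [g0_string k] for infinitely many [k]; flipping the next bit gives
    neighbours in [W] that converge to its image. *)
Lemma small_no_cluster W : analytic W ->
  (forall x, W x -> ~ clusters_at x [set y | W y /\ G x y]) -> small G W.
Proof.
move=> aW nacc; pose GW x y := [/\ W x, W y & G x y].
have aGW : analytic_rel GW.
  have c1 := @cont_slice bool false; have c2 := @cont_slice bool true.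
  have -> : analytic_rel GW = analytic ((slice false @^-1` W `&` slice true @^-1` W) `&`
      [set z | G (slice false z) (slice true z)]).
    by congr analytic; apply/seteqP; split=> z /= [] // [].
  by apply: analyticI aG; apply: analyticI; exact: analytic_preimage.
have [[B BP BT]|[phi cphi hphi]] := g0_dichotomy aGW.
  apply: (@smallS _ _ [set s | exists n, (B n `&` W) s]).
    by move=> s Ws; have [n Bn] := BT s I; exists n.
  apply: small_exists => n; have [bB iB] := BP n; apply: small_independent => //.
    by apply: analyticI => //; exact: borel_analytic.
  by move=> x y [Bx Wx] [By Wy] Gxy; exact: (iB x y).
have [n t|a _ aP] := @cantor_generic nat [::] (fun n s =>
  exists2 k, n <= k & g0_string k = s).
  (* The padding by [n] bits forces the length [k] to be at least [n]. *)
  have [k [r kr]] := g0_string_dense (t ++ nseq n false).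
  exists (nseq n false ++ r), k; last by rewrite kr -catA.
  by rewrite -(size_g0_string k) kr !size_cat size_nseq addnAC leq_addl.
have flip n : exists y, [/\ GW (phi a) y & agree n (phi a) y].
  have [m mP] := cont_agree cphi a n; have [s sa [k mk ks]] := aP m.
  rewrite -ks in sa; have [b ab Gab] := g0_hom_flip hphi sa.
  exists (phi b); split; last by apply: mP; exact: agreeW ab.
  by case: Gab => // -[? ? ?]; split=> //; exact: symG.
have [_ [[Wa _ _] _]] := flip 0; case: (nacc _ Wa) => n.
have [y [[_ Wy Gy] ya]] := flip n; exists y; split=> // yE.
by move: Gy; rewrite yE; exact: irrG.
Qed.

End LocallyFinite.

(** * Cliques in graphs without induced claws and $K_5$ minus an edge *)

Section Cliques.
Variable G : baire -> baire -> Prop.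
Hypotheses (symG : forall x y, G x y -> G y x) (irrG : forall x, ~ G x x).
Hypothesis claw_free : forall x y1 y2 y3, G x y1 -> G x y2 -> G x y3 ->
  y1 <> y2 -> y1 <> y3 -> y2 <> y3 -> [\/ G y1 y2, G y1 y3 | G y2 y3].
Hypothesis K5e_free : forall a b c d e, G c d -> G c e -> G d e ->
  G a c -> G a d -> G a e -> G b c -> G b d -> G b e -> a <> b -> G a b.

Definition adjeq x y := x = y \/ G x y.

Lemma adjeq_sym x y : adjeq x y -> adjeq y x.
Proof. by move=> [->|/symG]; [left|right]. Qed.

(* Nine is what [few_avoid] needs: it discards four sets of at most two indices. *)
Notation tuple9 := ('I_9 -> baire).
Implicit Types z : tuple9.

Definition clique z := forall i j, i != j -> G (z i) (z j).
Definition near_clique x z := forall i, adjeq x (z i).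
Definition sim z z' := forall i, near_clique (z i) z'.

Lemma clique_adjeq z i j : clique z -> adjeq (z i) (z j).
Proof. by move=> cz; have [->|/cz] := eqVneq i j; [left|right]. Qed.

Lemma sim_refl z : clique z -> sim z z.
Proof. by move=> cz i j; exact: clique_adjeq. Qed.

Lemma sim_sym z z' : sim z z' -> sim z' z.
Proof. by move=> zz' i j; exact/adjeq_sym/zz'. Qed.

(** If [a] and [b] were distinct, non-adjacent and different from the three vertices of [z], the
    five would induce $K_5$ minus an edge. Coincidences with one of these vertices are immediate. *)
Lemma adjeq_common z a b i j k : clique z -> i != j -> i != k -> j != k ->
  adjeq a (z i) -> adjeq a (z j) -> adjeq a (z k) -> near_clique b z -> adjeq a b.
Proof.
move=> cz ij ik jk ai aj ak bz.
have [->|ab] := pselect (a = b); first by left.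
have key l : adjeq a (z l) -> a = z l \/ (b = z l \/ (G a (z l) /\ G b (z l))).
  by move=> [|?]; [left|case: (bz l); [right; left|right; right]].
case: (key i ai) => [->|]; first exact/adjeq_sym/bz.
case: (key j aj) => [->|]; first by move=> _; exact/adjeq_sym/bz.
case: (key k ak) => [->|]; first by move=> _ _; exact/adjeq_sym/bz.
move=> [->//|[ak1 bk]] [->//|[aj1 bj]] [->//|[ai1 bi]]; right.
by apply: (@K5e_free _ _ (z i) (z j) (z k)) => //; exact: cz.
Qed.

Lemma three_near z a i j k : clique z -> i != j -> i != k -> j != k ->
  adjeq a (z i) -> adjeq a (z j) -> adjeq a (z k) -> near_clique a z.
Proof.
move=> cz ij ik jk ai aj ak l.
by apply: (adjeq_common cz ij ik jk) => // l'; exact: clique_adjeq.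
Qed.

Lemma sim_near z z' x : clique z -> near_clique x z -> sim z z' -> near_clique x z'.
Proof.
move=> cz xz zz' l; apply: (@adjeq_common z x _ ord0 (inord 1) (inord 2) cz);
  do ?exact: xz; do ?by rewrite -val_eqE /= !inordK.
by move=> i; exact/adjeq_sym/zz'.
Qed.

Lemma sim_trans z z' z'' : clique z' -> sim z z' -> sim z' z'' -> sim z z''.
Proof. by move=> cz' zz' z'z'' i; exact: sim_near (zz' i) z'z''. Qed.

Definition few (P : 'I_9 -> Prop) :=
  forall i j k, i != j -> j != k -> k != i -> P i -> P j -> P k -> False.

Lemma few_avoid P1 P2 P3 P4 : few P1 -> few P2 -> few P3 -> few P4 ->
  exists i, [/\ ~ P1 i, ~ P2 i, ~ P3 i & ~ P4 i].
Proof.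
pose A P := [set i : 'I_9 | `[< P i >]]%SET.
have fewA P : few P -> #|A P| <= 2.
  move=> fP; rewrite leqNgt; apply/negP => /card_gt2P[i [j [k [[]]]]].
  rewrite !inE => Pi Pj Pk [ij jk ki].
  exact: (fP i j k).
move=> f1 f2 f3 f4; apply: contrapT => /forallNP H.
have : #|[set: 'I_9]%SET| <= #|(A P1 :|: A P2) :|: (A P3 :|: A P4)|%SET.
  apply: subset_leq_card; apply/fintype.subsetP => i _; rewrite !inE;
    apply: contrapT => nP.
  apply: (H i); split=> Pi; apply: nP; move/asboolT: Pi => ->; by rewrite ?orbT.
have cU (B C : {set 'I_9}) b c : #|B| <= b -> #|C| <= c -> #|B :|: C|%SET <= b + c.
  by move=> Bb Cc; rewrite cardsU (leq_trans (leq_subr _ _))// leq_add.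
rewrite cardsT card_ord => /leq_trans/(_ (cU _ _ _ _ (cU _ _ _ _ (fewA _ f1) (fewA _ f2))
  (cU _ _ _ _ (fewA _ f3) (fewA _ f4)))).
by [].
Qed.

Lemma few_adjeq z a : clique z -> ~ near_clique a z -> few (fun i => adjeq a (z i)).
Proof.
move=> cz naz i j k ij jk ki ai aj ak; apply: naz.
by apply: (three_near cz ij _ jk) => //; rewrite eq_sym.
Qed.

Lemma few_near z z' : clique z -> ~ sim z z' -> few (fun i => near_clique (z i) z').
Proof.
move=> cz nzz' i j k ij jk ki iz jz kz; apply: nzz' => l l'; apply/adjeq_sym.
have ik : i != k by rewrite eq_sym.
by apply: (three_near cz ij ik jk) => //; exact/adjeq_sym.
Qed.

(** Were the cliques pairwise inequivalent, one vertex of each could be chosen, pairwise distinct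
    and non-adjacent: a claw at [x]. A vertex far from another of the cliques cannot be [x], which
    is near all three. *)
Lemma near_two_cliques x z1 z2 z3 : clique z1 -> clique z2 -> clique z3 ->
  near_clique x z1 -> near_clique x z2 -> near_clique x z3 -> [\/ sim z1 z2,
    sim z1 z3 | sim z2 z3].
Proof.
move=> c1 c2 c3 x1 x2 x3; apply: contrapT => nsim.
have n12 : ~ sim z1 z2 by move=> s; apply: nsim; constructor 1.
have n13 : ~ sim z1 z3 by move=> s; apply: nsim; constructor 2.
have n23 : ~ sim z2 z3 by move=> s; apply: nsim; constructor 3.
have n21 : ~ sim z2 z1 by move=> /sim_sym.
have n31 : ~ sim z3 z1 by move=> /sim_sym.
have n32 : ~ sim z3 z2 by move=> /sim_sym.
have [i1 [a12 a13 _ _]] := few_avoid (few_near c1 n12) (few_near c1 n13)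
  (few_near c1 n12) (few_near c1 n13).
have [i2 [a21 a23 a2 _]] := few_avoid (few_near c2 n21) (few_near c2 n23)
  (few_adjeq c2 a12) (few_near c2 n23).
(* Only this last choice must avoid four different sets: two for the other cliques and two for the
   vertices already chosen. *)
have [i3 [a31 a32 a3 a3']] := few_avoid (few_near c3 n31) (few_near c3 n32)
  (few_adjeq c3 a13) (few_adjeq c3 a23).
have xG z i z' : near_clique x z -> near_clique x z' -> ~ near_clique (z i) z' ->
  G x (z i).
  by move=> /(_ i)[->|] // xz'.
have := claw_free (xG _ _ _ x1 x2 a12) (xG _ _ _ x2 x1 a21) (xG _ _ _ x3 x1 a31).
case; do ?by [move=> H; apply: a2; left|move=> H; apply: a3; left|move=> H;
  apply: a3'; left].
- by move=> H; apply: a2; right.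
- by move=> H; apply: a3; right.
- by move=> H; apply: a3'; right.
Qed.

(** Otherwise [y], a vertex of [z] and a vertex of [z'], each chosen away from the others, form a
    claw at [x]. *)
Lemma adj_near x y z z' : clique z -> clique z' -> near_clique x z ->
  near_clique x z' -> ~ sim z z' ->
  G x y -> near_clique y z \/ near_clique y z'.
Proof.
move=> cz cz' xz xz' nzz' Gxy; apply: contrapT => /not_orP[nyz nyz'].
have nz'z : ~ sim z' z by move=> /sim_sym.
have [i [a1 a2 _ _]] := few_avoid (few_near cz nzz') (few_adjeq cz nyz)
  (few_near cz nzz') (few_near cz nzz').
have [j [b1 b2 b3 _]] := few_avoid (few_near cz' nz'z) (few_adjeq cz' nyz')
  (few_adjeq cz' a1) (few_near cz' nz'z).
have xG u k u' : near_clique x u -> near_clique x u' -> ~ near_clique (u k) u' ->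
  G x (u k).
  by move=> /(_ k)[->|] // xu'.
have := claw_free Gxy (xG _ _ _ xz xz' a1) (xG _ _ _ xz' xz b1).
case; do ?by [move=> H; apply: a2; left|move=> H; apply: b2; left|move=> H;
  apply: b3; left].
- by move=> H; apply: a2; right.
- by move=> H; apply: b2; right.
- by move=> H; apply: b3; right.
Qed.

(** A vertex [x] outside [z] replaces the first vertex; one already in [z] trades places with it. *)
Lemma clique_rebase x z : clique z -> near_clique x z ->
  exists z', [/\ clique z', z' ord0 = x & sim z' z].
Proof.
move=> cz xz.
pose z' i := if i == ord0 then x else if pselect (z i = x) then z ord0 else z i.
have z'z i : i != ord0 -> exists2 j, z' i = z j & z j <> x /\ (z i <> x ->
  j = i) /\ (z i = x -> j = ord0).
  rewrite /z' => /[dup] i0 /negPf ->; case: pselect => zi; last by exists i.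
  exists ord0 => //; split=> // z0; apply: (@irrG x).
  by rewrite -{1}z0 -zi; apply: cz; rewrite eq_sym.
exists z'; split=> // [i j ij|i].
  have x0 k : k != ord0 -> G x (z' k).
    by move=> /z'z[l -> [zlx _]]; case: (xz l) => // /esym.
  have [i0|i0] := eqVneq i ord0; first by rewrite {1}/z' i0 eqxx; apply: x0;
    rewrite -i0 eq_sym.
  have [j0|j0] := eqVneq j ord0; first by rewrite {2}/z' j0 eqxx; apply/symG/x0;
    rewrite -j0.
  have [k zk [kx [k1 k2]]] := z'z i i0; have [l zl [lx [l1 l2]]] := z'z j j0.
  rewrite zk zl; apply: (cz); apply/eqP => kl.
  have [zi|zi] := pselect (z i = x).
    have [zj|/l1 lj] := pselect (z j = x).
      by apply: (@irrG x); rewrite -{1}zi -zj; apply: cz.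
    by move: j0; rewrite -lj -kl k2// eqxx.
  have [zj|/l1 lj] := pselect (z j = x); last by move: ij; rewrite -(k1 zi) -lj kl eqxx.
  by move: i0; rewrite -(k1 zi) kl l2// eqxx.
have [->|i0] := eqVneq i ord0; first by rewrite /z' eqxx.
by have [k -> _] := z'z i i0; move=> l; exact: clique_adjeq.
Qed.

(** A Ramsey argument that preserves accumulation. If the non-neighbours of [y] accumulate at [x],
    take one of them, [v]: as there are no three independent points, every other non-neighbour of
    [y] is adjacent to [v]. *)
Lemma cluster_clique x (N : set baire) r : clusters_at x N ->
  (forall a b c, N a -> N b -> N c -> a <> b -> a <> c -> b <> c -> [\/ G a b,
    G a c | G b c]) ->
  exists f : nat -> baire, (forall i, i < r -> N (f i)) /\
    forall i j, i < r -> j < r -> i != j -> G (f i) (f j).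
Proof.
elim: r N => [|r IH] N aN N3; first by exists (fun=> x).
have [y Ny ay] : exists2 y, N y & clusters_at x [set u | N u /\ G y u].
  have [y [Ny yx]] := clusters_at_nonempty aN.
  have : clusters_at x ([set u | N u /\ G y u] `|` [set u | [/\ N u, u <> y & ~ G y u]]).
    apply: clusters_atS (clusters_atD1 y aN) => u [Nu /= uy].
    by have [?|?] := pselect (G y u); [left|right].
  move=> /clusters_atU[ay|an]; first by exists y.
  have [v [[Nv vy nGv] vx]] := clusters_at_nonempty an; exists v => //.
  apply: clusters_atS (clusters_atD1 v an) => u [[Nu uy nGu] /= uv]; split=> //.
  by have [] := N3 y v u Ny Nv Nu (nesym vy) (nesym uy) (nesym uv).
have [|f [fN fG]] := IH _ ay.
  by move=> a b c [? _] [? _] [? _]; exact: N3.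
exists (fun i => if i is i'.+1 then f i' else y); split; first by move=> [|i]// /fN[].
move=> [|i] [|j]//; last by exact: fG.
- by move=> _ /fN[].
- by move=> /fN[_ /symG].
Qed.

Lemma cluster_nbr_clique x (N : set baire) : clusters_at x N -> (forall y,
  N y -> G x y) ->
  exists z, [/\ clique z, z ord0 = x & forall i, i != ord0 -> N (z i)].
Proof.
(* Eight vertices of [N], with [x] in front, make a 9-clique. *)
move=> aN NG; have [|f [fN fG]] := cluster_clique 8 aN.
  by move=> a b c /NG Ga /NG Gb /NG Gc; exact: claw_free Ga Gb Gc.
exists (fun i => if val i is k.+1 then f k else x); split=> //.
  move=> [[|i] iP] [[|j] jP]//= ij; last exact: fG.
  - exact/NG/fN.
  - exact/symG/NG/fN.
by move=> [[|i] iP]//= _; exact: fN.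
Qed.

End Cliques.

(** * Complexity of the clique relation, and the case of a countable colouring of cliques *)

Lemma analyticU A B : analytic A -> analytic B -> analytic (A `|` B).
Proof.
move=> aA aB.
have -> : A `|` B = [set s | exists i : bool, (if i then A else B) s].
  by apply/seteqP; split=> s /= => [[?|?]|[[] ?]]; [exists true|exists false|left|right].
by apply: analytic_exists => -[].
Qed.

Lemma analytic_neq (f g : baire -> baire) : cont f -> cont g ->
  analytic [set z | f z <> g z].
Proof.
move=> cf cg; have -> : [set z | f z <> g z] =
    [set z | exists p : nat * nat * nat, p.1.2 <> p.2 /\ (f z p.1.1 = p.1.2 /\ g z
      p.1.1 = p.2)].
  apply/seteqP; split=> z /= => [fg|[[[k a] b] /= [ab [fz gz]]] fg];
    last by apply: ab; rewrite -fz fg.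
  have [k fgk] : exists k, f z k <> g z k.
    by apply: contrapT => /forallNP H; apply: fg; apply/funext => k;
      exact: contrapT (H k).
  by exists (k, f z k, g z k).
apply: analytic_exists => -[[k a] b] /=; apply: analyticI; first exact: analytic_cst.
have ev (h : baire -> baire) c : cont h -> analytic [set z | h z k = c].
  move=> ch; apply: (@analytic_preimage h [set s | s k = c]) => //.
  exact/borel_analytic/borel_baire_gen.
by apply: analyticI; exact: ev.
Qed.

Definition tup (z : baire) : 'I_9 -> baire := fun i => slice i z.

Lemma tup_pack u : tup (pack u) = u.
Proof. by apply/funext => i; exact: slice_pack. Qed.

Lemma cont_tup f i : cont f -> cont (fun z : nat -> nat => tup (f z) i).
Proof. by move=> cf; apply: (cont_comp cf); exact: cont_slice. Qed.

Definition clique_rel G (z z' : baire) :=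
  [/\ clique G (tup z), clique G (tup z'), sim G (tup z) (tup z') &
    tup z ord0 <> tup z' ord0].

Section CliqueRel.
Variable G : baire -> baire -> Prop.
Variables V Ghat : set baire.
Hypotheses (aV : analytic V) (bGhat : borel_baire Ghat).
Hypothesis GE : forall x y, G x y <-> [/\ V x, V y & Ghat (interleave x y)].
Hypotheses (symG : forall x y, G x y -> G y x) (irrG : forall x, ~ G x x).
Hypothesis claw_free : forall x y1 y2 y3, G x y1 -> G x y2 -> G x y3 ->
  y1 <> y2 -> y1 <> y3 -> y2 <> y3 -> [\/ G y1 y2, G y1 y3 | G y2 y3].
Hypothesis K5e_free : forall a b c d e, G c d -> G c e -> G d e ->
  G a c -> G a d -> G a e -> G b c -> G b d -> G b e -> a <> b -> G a b.

Local Notation clique := (clique G).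
Local Notation sim := (sim G).
Local Notation near_clique := (near_clique G).

Lemma analytic_G : analytic_rel G.
Proof.
have c1 := @cont_slice bool false; have c2 := @cont_slice bool true.
have -> : analytic_rel G = analytic ((slice false @^-1` V `&` slice true @^-1` V) `&`
    (fun z => interleave (slice false z) (slice true z)) @^-1` Ghat).
  by congr analytic; apply/seteqP; split=> z /=; rewrite GE => -[] // [].
apply: analyticI; first by apply: analyticI; exact: analytic_preimage.
by apply: analytic_preimage (borel_analytic bGhat); exact: cont_interleave.
Qed.

Lemma analytic_clique f : cont f -> analytic [set z | clique (tup (f z))].
Proof.
move=> cf; apply: analytic_forall => i; apply: analytic_forall => j; apply: analytic_imp.
by apply: (analytic_rel_comp analytic_G); exact: cont_tup.
Qed.

Lemma analytic_sim f g : cont f -> cont g -> analytic [set z | sim (tup (f z)) (tup (g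
  z))].
Proof.
move=> cf cg; apply: analytic_forall => i; apply: analytic_forall => j.
apply: analyticU; first by apply: analytic_eq; exact: cont_tup.
by apply: (analytic_rel_comp analytic_G); exact: cont_tup.
Qed.

(** Entries of a clique have neighbours and so lie in [V]; between points of [V], non-adjacency is
    the complement of the Borel set [Ghat], not merely coanalytic. *)
Lemma analytic_nsim f g : cont f -> cont g ->
  analytic [set z | [/\ clique (tup (f z)), clique (tup (g z)) &
    ~ sim (tup (f z)) (tup (g z))]].
Proof.
move=> cf cg.
have -> : [set z | [/\ clique (tup (f z)), clique (tup (g z)) &
  ~ sim (tup (f z)) (tup (g z))]] =
  ([set z | clique (tup (f z))] `&` [set z | clique (tup (g z))]) `&`
  [set z | exists i, exists j, tup (f z) i <> tup (g z) j /\
    ~ Ghat (interleave (tup (f z) i) (tup (g z) j))].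
  apply/seteqP; split=> z /=.
    move=> [cfz cgz ns]; split=> //; apply: contrapT => H; apply: ns => i j.
    have Vc u k : clique u -> V (u k).
      by move=> cu; have /GE[] : G (u k) (u (lift k ord0)) by apply: cu; exact: neq_lift.
    have [|nfg] := pselect (tup (f z) i = tup (g z) j); [by left|right].
    apply/GE; split; [exact: Vc|exact: Vc|]; apply: contrapT => nG; apply: H.
    by exists i, j.
  move=> [[cfz cgz] [i [j [fg nG]]]]; split=> // /(_ i j)[//|/GE[_ _]]; exact: nG.
apply: analyticI; first by apply: analyticI; exact: analytic_clique.
apply: analytic_exists => i; apply: analytic_exists => j; apply: analyticI.
  by apply: analytic_neq; exact: cont_tup.
apply: (@analytic_preimage (fun z => interleave (tup (f z) i) (tup (g z) j)) (~` Ghat)).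
  by apply: cont_interleave; exact: cont_tup.
exact/borel_analytic/borel_baireC.
Qed.

Lemma analytic_clique_rel : analytic_rel (clique_rel G).
Proof.
have c1 := @cont_slice bool false; have c2 := @cont_slice bool true.
have -> : analytic_rel (clique_rel G) = analytic (
    ([set z | clique (tup (slice false z))] `&` [set z | clique (tup (slice true z))]) `&`
    ([set z | sim (tup (slice false z)) (tup (slice true z))] `&`
     [set z | tup (slice false z) ord0 <> tup (slice true z) ord0])).
  by congr analytic; apply/seteqP; split=> z /= [] // [? ?] [].
apply: analyticI; apply: analyticI; do ?exact: analytic_clique; first exact: analytic_sim.
by apply: analytic_neq; exact: cont_tup.
Qed.

(** By independence, the cliques of [B] in the class of [t] share one first vertex, and a single
    point does not accumulate anywhere. *)
Lemma no_cluster_color (B : set baire) (t : 'I_9 ->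
  baire) x : independent (clique_rel G) B ->
  clique t ->
  ~ clusters_at x [set y | exists z, [/\ clique (tup z), tup z ord0 = y,
    B z & sim t (tup z)]].
Proof.
move=> iB ct a; have [y [[z [cz zy Bz tz]] _]] := clusters_at_nonempty a.
have [y' [[[z' [cz' zy' Bz' tz']] y'y] _]] := clusters_at_nonempty (clusters_atD1 y a).
apply: (iB z z') => //; split=> //; last by rewrite zy zy' => /esym.
exact: (sim_trans symG K5e_free ct (sim_sym symG tz) tz').
Qed.

Lemma clique_near0 u : clique u -> near_clique (u ord0) u.
Proof. by move=> cu i; exact: clique_adjeq. Qed.

(** Three kinds of vertices are treated: those that start two inequivalent cliques, of colours [p.1]
    and [p.2]; outside a small Borel set [W] absorbing them, those that start a clique of colour
    [k]; and those that start no 9-clique. On each piece, accumulating neighbours would give several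
    first vertices for one colour and class, or a 9-clique that cannot exist. *)
Lemma small_clique_rel : small (clique_rel G) setT -> small G setT.
Proof.
move=> [B BP BT]; have aG := analytic_G.
have c1 := @cont_slice bool false; have c2 := @cont_slice bool true.
have aB k f : cont f -> analytic [set z | B k (f z)].
  by move=> cf; apply: (analytic_preimage cf); apply: borel_analytic; have [] := BP k.
pose flag k x z := [/\ clique (tup z), tup z ord0 = x & B k z].
pose A k := [set x | exists z, flag k x z].
pose A2 (p : nat * nat) := [set x | exists z, exists z',
  [/\ flag p.1 x z, flag p.2 x z' & ~ sim (tup z) (tup z')]].
have flagP u x : clique u -> u ord0 = x -> exists k, flag k x (pack u).
  by move=> cu ux; have [k Bk] := BT (pack u) I; exists k; split; rewrite ?tup_pack.
have aflag k f g : cont f -> cont g -> analytic [set z | flag k (f z) (g z)].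
  move=> cf cg; have -> : [set z | flag k (f z) (g z)] = [set z | clique (tup (g z))] `&`
      ([set z | tup (g z) ord0 = f z] `&` [set z | B k (g z)]).
    by apply/seteqP; split=> z /= [] // ? [].
  apply: analyticI; first exact: analytic_clique.
  by apply: analyticI; [apply: analytic_eq => //; exact: cont_tup|exact: aB].
have aA k : analytic (A k).
  have -> : A k = [set x | exists z, [set w | flag k (slice true w) (slice false w)]
    (interleave z x)].
    by apply/seteqP; split=> x [z xz]; exists z; move: xz;
      rewrite /= interleave1 interleave2.
  exact/analytic_ex/aflag.
have aA2 p : analytic (A2 p).
  pose f w := slice false w; pose g w := slice false (slice true w);
    pose h w := slice true (slice true w).
  have cg : cont g by apply: (cont_comp c2).
  have ch : cont h by apply: (cont_comp c2).
  pose S := [set w | flag p.1 (h w) (g w)] `&` [set w | flag p.2 (h w) (f w)] `&`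
     [set w | [/\ clique (tup (g w)), clique (tup (f w)) &
       ~ sim (tup (g w)) (tup (f w))]].
  have -> : A2 p = [set x | exists z, [set v | exists z',
    S (interleave z' v)] (interleave z x)].
    apply/seteqP; split=> x [z [z' xz]]; exists z, z'; move: xz;
      rewrite /S /f /g /h /= !(interleave1, interleave2).
      by move=> [F F' ns]; have [? _ _] := F; have [? _ _] := F'.
    by move=> [[? ?] [_ _ ?]].
  apply: analytic_ex; apply: analytic_ex; apply: analyticI; last exact: analytic_nsim.
  by apply: analyticI; exact: aflag.
have sA2 p : small G (A2 p).
  apply: small_no_cluster => // x [z [z' [[cz zx Bz] [cz' zx' Bz'] ns]]] aN.
  have xz : near_clique x (tup z) by rewrite -zx; exact: clique_near0.
  have xz' : near_clique x (tup z') by rewrite -zx'; exact: clique_near0.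
  (* Of the two inequivalent cliques at such a [y], one is equivalent to [u], since [y] cannot be
     near three pairwise inequivalent cliques. *)
  have key u : clique u -> ~ clusters_at x [set y | A2 p y /\ near_clique y u].
    move=> cu aU; have : clusters_at x
      ([set y | exists z, [/\ clique (tup z), tup z ord0 = y,
        B p.1 z & sim u (tup z)]] `|`
       [set y | exists z, [/\ clique (tup z), tup z ord0 = y, B p.2 z & sim u (tup z)]]).
      apply: clusters_atS aU => y [[v [v' [[cv vy Bv] [cv' vy' Bv'] nvv']]] yu].
      have yv : near_clique y (tup v) by rewrite -vy; exact: clique_near0.
      have yv' : near_clique y (tup v') by rewrite -vy'; exact: clique_near0.
      have [uv|uv'|//] := near_two_cliques symG claw_free K5e_free cu cv cv' yu yv yv'.
        by left; exists v.
      by right; exists v'.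
    by case/clusters_atU; apply: no_cluster_color => //; have [] := BP p.1;
      have [] := BP p.2.
  have : clusters_at x ([set y | A2 p y /\ near_clique y (tup z)] `|` [set y | A2 p y
    /\ near_clique y (tup z')]).
    apply: clusters_atS aN => y [yA Gxy].
    by have [?|?] := adj_near symG claw_free K5e_free cz cz' xz xz' ns Gxy; [left|right].
  by case/clusters_atU; exact: key.
(* [W] is Borel so that the pieces outside it are again analytic. *)
have [W [bW sW A2W]] := small_borel (small_exists sA2).
have flag_sim x k k' z z' : ~ W x -> flag k x z -> flag k' x z' -> sim (tup z) (tup z').
  move=> nW F F'; apply: contrapT => ns; apply: nW; apply: A2W.
  by exists (k, k'), z, z'.
have sA k : small G (A k `&` ~` W).
  apply: small_no_cluster => //; first by apply: analyticI => //;
    exact/borel_analytic/borel_baireC.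
  move=> x [[z F] nWx] aN; have [cz zx Bz] := F.
  have xz : near_clique x (tup z) by rewrite -zx; exact: clique_near0.
  have : clusters_at x ([set y | exists z', [/\ clique (tup z'), tup z' ord0 = y,
    B k z' & sim (tup z) (tup z')]] `|`
      [set y | G x y /\ ~ near_clique y (tup z)]).
    apply: clusters_atS aN => y [[[zy Fy] nWy] Gxy].
    have [yz|] := pselect (near_clique y (tup z)); [left|by right].
    (* The rebased clique starts at [y]; as [y] is outside [W], its clique of colour [k] is
       equivalent to it, hence to [z]. *)
    have [u [cu uy uz]] := clique_rebase symG irrG cz yz.
    have [k' Fu] := flagP u y cu uy.
    have := flag_sim _ _ _ _ _ nWy Fy Fu; rewrite tup_pack => s.
    exists zy; have [? ? ?] := Fy; split=> //.
    exact: (sim_trans symG K5e_free cu (sim_sym symG uz) (sim_sym symG s)).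
  case/clusters_atU; first by apply: no_cluster_color => //; have [] := BP k.
  (* With [x], some of these neighbours form a clique, which is equivalent to [z] because [x] is
     outside [W]; so they would be near [z]. *)
  move=> aN'; have [y []//|u [cu ux uN]] := cluster_nbr_clique symG claw_free aN'.
  have [k' Fu] := flagP u x cu ux.
  have := flag_sim _ _ _ _ _ nWx Fu F; rewrite tup_pack => s.
  by have [_] := uN (lift ord0 ord0) isT; apply; exact: s.
have [W' [bW' sW' AW']] := small_borel (smallU sW (small_exists sA)).
apply: (@smallS _ _ (W' `|` ~` W')); first by move=> s _; exact: (lem (W' s)).
apply: smallU => //; apply: small_no_cluster => //;
  first exact/borel_analytic/borel_baireC.
move=> x nW' aN; have [y []//|u [cu ux uN]] := cluster_nbr_clique symG claw_free aN.
have [k Fu] := flagP u x cu ux; apply: nW'; apply: AW'.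
have [?|?] := pselect (W x); [by left|right].
by exists k; split=> //; exists (pack u).
Qed.

End CliqueRel.

(** * Generic pairs and the embedding of K_0 *)

Section Forcing.
Variables (K : countType) (T : Type) (le : K -> K -> Prop) (mem : T -> K -> Prop).
Hypotheses (le_refl : forall c, le c c)
  (le_trans : forall d c e, le c d -> le d e -> le c e)
  (mem_le : forall t c d, le c d -> mem t c -> mem t d)
  (mem_directed : forall t c d, mem t c -> mem t d -> exists e, [/\ le e c,
    le e d & mem t e]).

Definition dense_below c (U : set K) := forall d, le d c -> exists2 e, le e d & U e.

(** Category in terms of conditions: [A] is comeager in the basic set [c], as witnessed by countably
    many sets of conditions dense below [c]. Correspondingly, [decided] is a form of the Baire
    property. *)
Definition forces c (A : set T) := exists2 U : nat -> set K,
  forall n, dense_below c (U n) &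
  forall t, mem t c -> (forall n, exists2 e, mem t e & U n e) -> A t.

Definition decided (A : set T) :=
  forall c, exists2 d, le d c & forces d A \/ forces d (~` A).

Lemma forces_countable (I : countType) c A (U : I -> set K) :
  (forall i, dense_below c (U i)) ->
  (forall t, mem t c -> (forall i, exists2 e, mem t e & U i e) -> A t) -> forces c A.
Proof.
move=> dU UA; exists (fun n => if @unpickle I n is Some i then U i else [set _ | True]).
  by move=> n; case: unpickle => [i|d dc]; [exact: dU|exists d].
move=> t tc H; apply: UA => // i; have := H (pickle i); rewrite pickleK; exact.
Qed.

Lemma forces_forall (I : countType) c (A : I -> set T) :
  (forall i, forces c (A i)) -> forces c [set t | forall i, A i t].
Proof.
move=> H; have {H}/choice[U UP] i : exists U : nat -> set K,
    (forall n, dense_below c (U n)) /\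
    forall t, mem t c -> (forall n, exists2 e, mem t e & U n e) -> A i t.
  by have [U ? ?] := H i; exists U.
apply: (@forces_countable (I * nat)%type _ _ (fun p => U p.1 p.2)).
  by move=> [i n]; have [+ _] := UP i; exact.
by move=> t tc H i; have [_] := UP i; apply=> // n; exact: (H (i, n)).
Qed.

(** Comeagerness is local. In place of a maximal antichain, each [d] that forces [A] contributes the
    dense sets of conditions incompatible with [d] or in [U d n]; the index [None] asks for one such
    [d]. Countability of [K] keeps the family countable. *)
Lemma forces_dense c A : dense_below c [set d | forces d A] -> forces c A.
Proof.
move=> dA; have /choice[U UP] d : exists U : nat -> set K, forces d A ->
    (forall n, dense_below d (U n)) /\
    forall t, mem t d -> (forall n, exists2 e, mem t e & U n e) -> A t.
  have [[U ? ?]|?] := pselect (forces d A); first by exists U.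
  by exists (fun _ => setT).
pose incomp d e := forall f, le f d -> ~ le f e.
apply: (@forces_countable (option (K * nat)) _ _ (fun o => if o is Some (d, n)
  then [set e | forces d A -> incomp d e \/ U d n e] else [set d | forces d A])).
  move=> [[d n]|] //= e ec; have [fd|nfd] := pselect (forces d A); last by exists e.
  have [|] := pselect (incomp d e); first by exists e => // _; left.
  move/existsNP => [f /not_implyP[fd' /contrapT fe]].
  have [dU _] := UP d fd; have [g gf Ug] := dU n f fd'.
  by exists g; [exact: le_trans fe|right].
move=> t tc H; have [d td fd] := H None; have [dU UA] := UP d fd.
apply: UA => // n; have [e te] := H (Some (d, n)); move=> /(_ fd)[inc|]; last by exists e.
by have [f [fd' fe _]] := mem_directed td te; case: (inc f).
Qed.

Lemma forces_subset c A B : A `<=` B -> forces c A -> forces c B.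
Proof. by move=> AB [U dU UA]; exists U => // t tc H; exact/AB/UA. Qed.

Lemma decidedC A : decided A -> decided (~` A).
Proof.
move=> dA c; have [d dc H] := dA c; exists d => //.
by rewrite setCK; case: H; [right|left].
Qed.

(** If no extension of [c] forces any [F i], then each complement is forced densely below [c], hence
    by [c] itself. *)
Lemma decided_exists (I : countType) (F : I -> set T) :
  (forall i, decided (F i)) -> decided [set t | exists i, F i t].
Proof.
move=> dF c.
have [[d dc [i fd]]|H] := pselect (exists2 d, le d c & exists i, forces d (F i)).
  by exists d => //; left; apply: forces_subset fd => t Ft; exists i.
exists c => //; right; apply: (@forces_subset _ [set t | forall i, (~` F i) t]).
  by move=> t Ft [i]; exact: Ft.
apply: forces_forall => i; apply: forces_dense => d dc.
have [e ed [fe|fe]] := dF i d; last by exists e.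
by case: H; exists e; [exact: le_trans dc|exists i].
Qed.

Lemma decided_borel (h : T -> baire) A :
  (forall c k, exists2 d, le d c & exists m, forall t, mem t d -> h t k = m) ->
  borel_baire A -> decided (h @^-1` A).
Proof.
move=> hP; elim=> [k m c|B _|F _ IH]; [|exact: decidedC|exact: (decided_exists IH)].
have [d dc [m' dm]] := hP c k; exists d => //.
have dT : dense_below d setT by move=> e ed; exists e.
have [mm|mm] := eqVneq m' m; [left|right]; exists (fun=> setT) => // t /dm /=.
  by rewrite mm.
by move=> -> _; apply/eqP.
Qed.

End Forcing.

(** * The Cantor scheme built on a $G_0$-homomorphism into cliques *)

Section Embedding.
Variable G : baire -> baire -> Prop.
Variables V Ghat : set baire.
Hypotheses (aV : analytic V) (bGhat : borel_baire Ghat).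
Hypothesis GE : forall x y, G x y <-> [/\ V x, V y & Ghat (interleave x y)].
Hypotheses (symG : forall x y, G x y -> G y x) (irrG : forall x, ~ G x x).
Hypothesis K5e_free : forall a b c d e, G c d -> G c e -> G d e ->
  G a c -> G a d -> G a e -> G b c -> G b d -> G b e -> a <> b -> G a b.
Hypothesis countG : forall x, exists e : nat -> baire, forall y, G x y -> exists i,
  y = e i.
Variable Phi : cantor -> baire.
Hypotheses (cPhi : cont Phi) (hPhi : g0_hom (clique_rel G) Phi).

Local Notation sim a b := (sim G (tup (Phi a)) (tup (Phi b))).

Definition base a := tup (Phi a) ord0.

Lemma cont_base : cont base.
Proof. by apply: (cont_comp cPhi); exact: cont_slice. Qed.

Lemma clique_Phi a : clique G (tup (Phi a)).
Proof.
have a0 : starts (g0_string 0) a by move=> k; rewrite size_g0_string.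
by have [b _ []] := g0_hom_flip hPhi a0 => -[].
Qed.

(** $G_0$ generates $E_0$: to change the last bit, move the rest of the string to [g0_string n] by
    induction, cross one edge, and move on to the target. *)
Lemma sim_prepend s t a : size s = size t -> sim (prepend s a) (prepend t a).
Proof.
move: {2}(size s) (erefl (size s)) => n; elim: n s t a => [|n IH] s t a.
  move=> /size0nil -> /esym/size0nil ->; apply: sim_refl; exact: clique_Phi.
elim/last_ind: s => // s i _; elim/last_ind: t => [|t j _];
  rewrite !size_rcons // => -[sn] [st].
have tn : size t = n by rewrite -st.
rewrite !prepend_rcons.
have [<-|ij] := eqVneq i j; first exact: IH.
have := hPhi n a; rewrite !prepend_rcons => -[_ _ g01 _].
have gij : sim (prepend (g0_string n) (prepend [:: i] a)) (prepend (g0_string n)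
  (prepend [:: j] a)).
  by case: i j ij => [] [] // _; exact: (sim_sym symG g01).
have tr := sim_trans symG K5e_free (clique_Phi _).
by apply: tr (IH _ _ _ sn _) (tr _ _ _ gij (IH _ _ _ _ _)); rewrite size_g0_string.
Qed.

Definition eventually_eq (a b : cantor) := exists m, forall n, m <= n -> a n = b n.

Lemma sim_eventually_eq a b : eventually_eq a b -> sim a b.
Proof.
move=> [m ab].
rewrite (prepend_mkseq a m) (prepend_mkseq b m).
have -> : (fun n => b (m + n)) = (fun n => a (m + n)).
  by apply/funext => n; rewrite ab// leq_addr.
by apply: sim_prepend; rewrite !size_mkseq.
Qed.

Lemma base_eventually_eq a b : eventually_eq a b -> base a <> base b ->
  G (base a) (base b).
Proof. by move=> /sim_eventually_eq/(_ ord0 ord0)[]. Qed.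

Lemma V_base a : V (base a).
Proof.
have /GE[] // : G (base a) (tup (Phi a) (lift ord0 ord0)).
by apply: clique_Phi; exact: neq_lift.
Qed.

Lemma G_base a b : G (base a) (base b) <-> Ghat (interleave (base a) (base b)).
Proof. by rewrite GE; split=> [[]|] //; split=> //; exact: V_base. Qed.

(** Every cylinder contains an edge of $G_0$, whose ends have distinct first vertices by the last
    clause of [clique_rel]. *)
Lemma base_nonconstant p y : exists2 a, starts p a & base a <> y.
Proof.
have [k [r kr]] := g0_string_dense p.
have [_ _ _ ne] := hPhi k (fun=> false).
have st i : starts p (prepend (rcons (g0_string k) i) (fun=> false)).
  by apply: (@starts_cat _ (rcons r i)); rewrite -rcons_cat -kr; exact: starts_prepend.
have [e0|] := pselect (base (prepend (rcons (g0_string k) false) (fun=> false)) = y).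
  exists (prepend (rcons (g0_string k) true) (fun=> false)) => //.
  by move=> e1; apply: ne; rewrite -/(base _) -/(base _) e0 e1.
by exists (prepend (rcons (g0_string k) false) (fun=> false)).
Qed.

Lemma neq_coord (x y : baire) : x <> y -> exists k, x k <> y k.
Proof.
move=> xy; apply: contrapT => /forallNP H; apply: xy; apply/funext => k.
exact: contrapT (H k).
Qed.

Lemma base_avoid p y : exists r, forall a, starts (p ++ r) a -> base a <> y.
Proof.
have [a pa /neq_coord[k ak]] := base_nonconstant p y.
have [m mP] := cont_base a k.
have [r rE] : exists r, mkseq a (maxn m (size p)) = p ++ r.
  by apply: (@starts_prefix _ _ a) => //; [rewrite size_mkseq leq_maxr|exact:
    starts_mkseq].
exists r => b; rewrite -rE => /starts_agree ab by_; apply: ak; rewrite -by_.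
by apply: mP; apply: agreeW ab; exact: leq_maxl.
Qed.

Lemma base_separate p q : exists r r', forall a b,
  starts (p ++ r) a -> starts (q ++ r') b ->
  base a <> base b.
Proof.
pose b0 := prepend q (fun=> false).
have [a0 pa /neq_coord[k ak]] := base_nonconstant p (base b0).
have [m mP] := cont_base a0 k; have [m' m'P] := cont_base b0 k.
have [r rE] : exists r, mkseq a0 (maxn m (size p)) = p ++ r.
  by apply: (@starts_prefix _ _ a0) => //; [rewrite size_mkseq leq_maxr|exact:
    starts_mkseq].
have [r' r'E] : exists r, mkseq b0 (maxn m' (size q)) = q ++ r.
  apply: (@starts_prefix _ _ b0); [by rewrite size_mkseq leq_maxr| |exact: starts_mkseq].
  exact: starts_prepend.
exists r, r' => a b; rewrite -rE -r'E => /starts_agree aa /starts_agree bb ab.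
apply: ak; rewrite (mP a) ?(m'P b) ?ab//.
  by apply: agreeW bb; exact: leq_maxl.
by apply: agreeW aa; exact: leq_maxl.
Qed.

Notation cond := (seq bool * seq bool)%type.
Definition cond_le (c d : cond) := exists r, c = (d.1 ++ r.1, d.2 ++ r.2).
Definition cond_mem (w : cantor * cantor) (c : cond) := starts c.1 w.1 /\ starts c.2 w.2.

Lemma cond_le_refl c : cond_le c c.
Proof. by exists ([::], [::]); rewrite !cats0; case: c. Qed.

Lemma cond_le_trans d c e : cond_le c d -> cond_le d e -> cond_le c e.
Proof. by move=> [r ->] [t ->]; exists (t.1 ++ r.1, t.2 ++ r.2); rewrite !catA. Qed.

Lemma cond_mem_le w c d : cond_le c d -> cond_mem w c -> cond_mem w d.
Proof. by move=> [r ->] [/starts_cat ? /starts_cat]. Qed.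

Lemma starts_total s t a : starts s a -> starts t a ->
  exists u, [/\ exists r, u = s ++ r, exists r, u = t ++ r & starts u a].
Proof.
move=> sa ta; case: (leqP (size s) (size t)) => st.
  exists t; split=> //; [exact: starts_prefix st sa ta|by exists [::]; rewrite cats0].
exists s; split=> //; [by exists [::]; rewrite cats0|exact: starts_prefix (ltnW st) ta
  sa].
Qed.

Lemma cond_mem_directed w c d : cond_mem w c -> cond_mem w d ->
  exists e, [/\ cond_le e c, cond_le e d & cond_mem w e].
Proof.
move=> [c1 c2] [d1 d2]; have [u [[r ->] [t rt] uw]] := starts_total c1 d1.
have [u' [[r' ->] [t' rt'] uw']] := starts_total c2 d2.
by exists (c.1 ++ r, c.2 ++ r'); split=> //; [exists (r, r')|exists (t, t');
  rewrite rt rt'].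
Qed.

Local Notation forces := (forces cond_le cond_mem).
Definition adj_set : set (cantor * cantor) := [set w | G (base w.1) (base w.2)].

Lemma decided_adj : decided cond_le cond_mem adj_set.
Proof.
have -> : adj_set = (fun w : cantor * cantor => interleave (base w.1) (base w.2))
  @^-1` Ghat.
  by apply/seteqP; split=> w /G_base.
apply: decided_borel bGhat => //.
- exact: cond_le_refl.
- exact: cond_le_trans.
- exact: cond_mem_directed.
move=> [p q] k; rewrite /interleave /pack; case: unpickle => [[i j]|]; last first.
  by exists (p, q); [exact: cond_le_refl|exists 0].
(* The coordinate belongs to one component, whose stem is extended until continuity fixes the
   value. *)
pose a i : cantor := prepend (if i then q else p) (fun=> false).
have [m mP] := cont_base (a i) j.
have [r rE] : exists r, mkseq (a i) (maxn m (size (if i then q else p))) = (if i then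
  q else p) ++ r.
  apply: (@starts_prefix _ _ (a i)); [by rewrite size_mkseq leq_maxr| |exact:
    starts_mkseq].
  exact: starts_prepend.
have aP b : starts ((if i then q else p) ++ r) b -> base b j = base (a i) j.
  rewrite -rE => /starts_agree ab; apply/esym/mP; apply: agreeW ab; exact: leq_maxl.
case: i a mP rE aP => a mP rE aP.
  exists (p, q ++ r); first by exists ([::], r); rewrite cats0.
  by exists (base (a true) j) => w [_ /aP].
exists (p ++ r, q); first by exists (r, [::]); rewrite cats0.
by exists (base (a false) j) => w [/aP].
Qed.

(* Kuratowski--Ulam: a nonmeager adjacency relation would be generic in some
   section, but sections are countable unions of closed nowhere dense sets. *)
Lemma not_forces_adj c : ~ forces c adj_set.
Proof.
case: c => p q [U dU UA].
(* For generic [a], the conditions of [U n] whose first part is a prefix of [a] have second parts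
   that are dense below [q]. *)
have [[n r] t|a pa aP] := @cantor_generic (nat * seq bool)%type p (fun i s =>
  exists p1 q1 t t', [/\ U i.1 (p1, q1), s = p1 ++ t & q1 = q ++ i.2 ++ t']).
  have [|_ [[x y] ->] Ue] := dU n (p ++ t, q ++ r); first by exists (t, r).
  exists x, (p ++ t ++ x), (q ++ r ++ y), [::], y; rewrite cats0; split=> //.
  by rewrite /= -!catA in Ue.
have [e eP] := countG (base a).
(* The generic [b] meets these sections and keeps [base b] off the countable list of neighbours of
   [base a]. *)
have [[[] n] t|b qb bP] := @cantor_generic (bool * nat)%type q (fun i s =>
  if i.1 then exists p1 q1 t, [/\ U i.2 (p1, q1), starts p1 a & s = q1 ++ t]
  else forall b, starts s b -> base b <> e i.2).
- have [s sa [p1 [q1 [u [t' [Upq /= sE qE]]]]]] := aP (n, t).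
  exists t', p1, q1, [::]; rewrite cats0; split=> //.
  by apply: (@starts_cat _ u); rewrite -sE.
- by have [r rP] := base_avoid (q ++ t) (e n); exists r; rewrite catA.
have /eP[i bi] : G (base a) (base b).
  apply: (UA (a, b)) => // n; have [s sb [p1 [q1 [t [Upq pa1 sE]]]]] := bP (true, n).
  by exists (p1, q1) => //; split=> //=; apply: (@starts_cat _ t); rewrite -sE.
by have [s sb /(_ b sb)] := bP (false, i).
Qed.

Lemma forces_nonadj : forces ([::], [::]) (~` adj_set).
Proof.
apply: forces_dense.
- exact: cond_le_refl.
- exact: cond_le_trans.
- exact: cond_mem_directed.
move=> c _; have [d dc [/not_forces_adj//|]] := decided_adj c.
by exists d.
Qed.

(** Forcing is replaced by decreasing dense open sets: [good n] combines the first [n.+1] dense sets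
    with separation of the two values, so meeting it for infinitely many [n] suffices. *)
Lemma good_ex : exists good : nat -> set cond, [/\
  forall n c d, cond_le c d -> good n d -> good n c,
  forall n c, exists2 d, cond_le d c & good n d,
  forall n w c, good n c -> cond_mem w c -> base w.1 <> base w.2 &
  forall w, (forall m, exists n c, [/\ m <= n, good n c & cond_mem w c]) ->
    ~ G (base w.1) (base w.2)].
Proof.
have [U dU UA] := forces_nonadj.
pose good n c := (forall w, cond_mem w c -> base w.1 <> base w.2) /\
  forall j, j <= n -> exists2 e, cond_le c e & U j e.
exists good; split.
- move=> n c d cd [sd Ud]; split=> [w wc|j jn]; first exact: sd (cond_mem_le cd wc).
  by have [e de Ue] := Ud j jn; exists e => //; exact: cond_le_trans de.
- move=> n c; have [r [r' rr']] := base_separate c.1 c.2.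
  have [d dc Ud] : exists2 d, cond_le d (c.1 ++ r, c.2 ++ r') &
      forall j, j < n.+1 -> exists2 e, cond_le d e & U j e.
    elim: n.+1 => [|m [d dc Ud]].
      by exists (c.1 ++ r, c.2 ++ r') => //; exact: cond_le_refl.
    have [|e ed Ue] := dU m d; first by exists d; case: (d).
    exists e; first exact: cond_le_trans dc.
    move=> j; rewrite ltnS leq_eqVlt => /predU1P[->|/Ud[f df Uf]].
      by exists e => //; exact: cond_le_refl.
    by exists f => //; exact: cond_le_trans df.
  exists d; first by apply: cond_le_trans dc _; exists (r, r').
  by split=> // w /(cond_mem_le dc)[w1 w2]; exact: rr'.
- by move=> n w c [+ _]; exact.
- move=> w H; apply: (UA w) => // n; have [m [c [nm [_ Uc] wc]]] := H n.
  by have [e ce Ue] := Uc n nm; exists e => //; exact: cond_mem_le wc.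
Qed.

(** A single pair of blocks is lengthened for each pair of stems in turn; as [D] is closed under
    extension, earlier successes persist. *)
Lemma good_blocks (D : set cond) :
  (forall c d, cond_le c d -> D d -> D c) -> (forall c, exists2 d, cond_le d c & D d) ->
  forall W : seq cond, exists u : cond, [/\ size u.1 = size u.2, 0 < size u.1 &
    forall c, c \in W -> D (c.1 ++ u.1, c.2 ++ u.2)].
Proof.
move=> Dle dD; elim=> [|c W [u [su u0 uP]]]; first by exists ([:: false], [:: false]).
have [_ [r ->] Dr] := dD (c.1 ++ u.1, c.2 ++ u.2).
(* Each side is padded by the length added to the other, which keeps the two blocks equally long. *)
pose x := u.1 ++ r.1 ++ nseq (size r.2) false;
  pose y := u.2 ++ r.2 ++ nseq (size r.1) false.
exists (x, y); split.
- by rewrite /= !size_cat !size_nseq su (addnC (size r.1)).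
- by rewrite /= size_cat ltn_addr.
move=> d; rewrite inE => /predU1P[->|/uP].
  by apply: Dle Dr; exists (nseq (size r.2) false, nseq (size r.1) false);
    rewrite /= -!catA.
by apply: Dle; exists (r.1 ++ nseq (size r.2) false, r.2 ++ nseq (size r.1) false);
  rewrite /= -!catA.
Qed.

(** The block appended at stage [n] depends only on [n] and the bit [a n], and both blocks are
    equally long, so $E_0$-equivalent arguments yield sequences with a common tail. Where [a n] is
    false and [b n] true, the pair of sequences lies in a good condition of level [n]; infinitely
    many such [n] exclude adjacency. *)
Theorem clique_hom_K0_embedding : exists psi : cantor -> baire, [/\ cont psi,
  injective psi,
  forall a, V (psi a) &
  forall a b, G (psi a) (psi b) <-> a <> b /\ eventually_eq a b].
Proof.
have [good [good_le good_dense good_sep good_nadj]] := good_ex.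
have /choice[next nextP] (p : nat * seq (seq bool)) : exists u : cond,
    [/\ size u.1 = size u.2, 0 < size u.1 &
      forall s t, s \in p.2 -> t \in p.2 -> good p.1 (s ++ u.1, t ++ u.2)].
  have [u [su u0 uP]] := good_blocks (good_le p.1) (good_dense p.1) [seq (s,
    t) | s <- p.2, t <- p.2].
  exists u; split=> // s t sp tp; apply: (uP (s, t)); exact: allpairs_f.
pose words := fix words n := if n is m.+1 then
  [seq s ++ (next (m, words m)).1 | s <- words m] ++ [seq s ++ (next (m,
    words m)).2 | s <- words m]
  else [:: [::]].
pose block n (i : bool) := if i then (next (n, words n)).2 else (next (n, words n)).1.
pose word := fix word (a : cantor) n := if n is m.+1 then word a m ++ block m (a m)
  else [::].
have wordW a n : word a n \in words n.
  elim: n => [|n IH] //=; rewrite mem_cat /block.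
  by case: (a n); rewrite (map_f (cat^~ _))// orbT.
have size_block n i : size (block n i) = size (block n false).
  by rewrite /block; case: i => //; have [] := nextP (n, words n).
have block_gt0 n i : 0 < size (block n i) by rewrite size_block;
  have [] := nextP (n, words n).
have size_word a b n : size (word a n) = size (word b n).
  by elim: n => //= n IH; rewrite !size_cat IH size_block (size_block _ (b n)).
have word_ge a n : n <= size (word a n).
  elim: n => //= n IH; rewrite size_cat -addn1; exact: leq_add.
have /choice[w wP] a : exists b, forall n, starts (word a n) b.
  by apply: string_chain => [n|n]; [exists (block n (a n))|exact: word_ge].
have word_agree a b n : agree n a b -> word a n = word b n.
  by elim: n => //= n IH ab; rewrite IH ?ab//; exact: agreeW ab.
have w_nth a n k : k < size (word a n) -> w a k = nth false (word a n) k by move=> /wP.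
have cw : cont w.
  by move=> a k; exists k.+1 => b ab; rewrite !(@w_nth _ k.+1) ?word_ge// (word_agree
    _ _ _ ab).
have w_eq a b : eventually_eq a b -> eventually_eq (w a) (w b).
  move=> [m ab]; exists (size (word a m)) => k mk.
  have tail d : exists r, word a (m + d) = word a m ++ r /\ word b (m + d) = word b m
    ++ r.
    elim: d => [|d [r [ra rb]]]; first by exists [::]; rewrite addn0 !cats0.
    exists (r ++ block (m + d) (a (m + d))); rewrite addnS /= ra rb -!catA.
    by rewrite -(ab (m + d) (leq_addr _ _)).
  have [r [ra rb]] := tail k.+1.
  have ka : k < size (word a (m + k.+1)) by rewrite (leq_trans _ (word_ge _ _))//
    leq_addl.
  rewrite (w_nth a (m + k.+1))// (w_nth b (m + k.+1)) 1?(size_word b a)//.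
  by rewrite ra rb !nth_cat (size_word b a) ltnNge mk.
have mem_good a b n : a n = false -> b n = true ->
    exists c, good n c /\ cond_mem (w a, w b) c.
  move=> an bn; have [_ _ gP] := nextP (n, words n).
  exists (word a n ++ block n false, word b n ++ block n true); split; first exact: gP.
  by split=> /=; [have := wP a n.+1; rewrite /= an|have := wP b n.+1; rewrite /= bn].
have sep a b : a <> b -> base (w a) <> base (w b).
  move=> ab; have [k abk] : exists k, a k <> b k.
    by apply: contrapT => /forallNP H; apply: ab; apply/funext => k;
      exact: contrapT (H k).
  case ak: (a k) abk => bk; last first.
    have [|c [gc mc]] := mem_good a b k ak; first by case: (b k) bk.
    exact: good_sep gc mc.
  have [||c [gc mc]] := mem_good b a k; [by case: (b k) bk|by []|].
  by move/esym; exact: good_sep gc mc.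
have nonadj a b : (forall m, exists n, [/\ m <= n, a n = false & b n = true]) ->
    ~ G (base (w a)) (base (w b)).
  move=> H; apply: (good_nadj (w a, w b)) => m; have [n [mn an bn]] := H m.
  by have [c [gc mc]] := mem_good _ _ _ an bn; exists n, c.
exists (fun a => base (w a)); split.
- exact: cont_comp cw cont_base.
- by move=> a b ab; apply: contrapT => /sep.
- by move=> a; exact: V_base.
move=> a b; split=> [Gab|[ab /w_eq wab]]; last by apply: base_eventually_eq => //;
  exact: sep.
split=> [ab|]; first by move: Gab; rewrite ab; exact: irrG.
apply: contrapT => nab.
(* Inequivalent [a] and [b] differ infinitely often, hence infinitely often in one of the two
   directions; the second reduces to the first by symmetry of [G]. *)
have [H|/existsNP[m mP]] := pselect (forall m, exists n, [/\ m <= n,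
  a n = false & b n = true]).
  exact: nonadj H Gab.
apply: (nonadj b a _ (symG Gab)) => m'; apply: contrapT => H; apply: nab.
exists (maxn m m') => n; rewrite geq_max => /andP[mn m'n].
case an: (a n); case bn: (b n) => //.
  by case: H; exists n.
by case: mP; exists n.
Qed.

End Embedding.

(** * Coding standard Borel spaces *)

Definition borel_preimages (T : Type) (h : T -> baire) : set_system T :=
  [set A | exists2 B, borel_baire B & A = h @^-1` B].

Lemma borel_preimages_sigma T (h : T -> baire) : sigma_algebra setT (borel_preimages h).
Proof.
split.
- by exists [set _ | False]; [exact: borel_baire_cst|apply/seteqP; split].
- by move=> _ [B bB ->]; exists (~` B); [exact: borel_baireC|rewrite setTD].
- move=> F FP; have /choice[B BP] n : exists B, borel_baire B /\ F n = h @^-1` B.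
    by have [B ? ?] := FP n; exists B.
  exists [set s | exists n, B n s].
    by apply: borel_baire_bigcup => n; have [] := BP n.
  apply/seteqP; split=> x /= [n]; first by have [_ ->] := BP n; exists n.
  by move=> Bn; exists n => //; have [_ ->] := BP n.
Qed.

Lemma sigma_algebra_borel_baire T (h : T -> baire) (M : set_system T) :
  sigma_algebra setT M -> (forall k m, M [set t | h t k = m]) ->
  forall B, borel_baire B -> M (h @^-1` B).
Proof.
move=> [_ MC MU] Mgen B; elim=> [k m|A _ MA|F _ MF]; first exact: Mgen.
  by have := MC _ MA; rewrite setTD.
have -> : h @^-1` [set s | exists n, F n s] = \bigcup_n (h @^-1` F n).
  by apply/seteqP; split=> t /= [n]; [exists n|move=> ? ?; exists n].
exact: MU.
Qed.

Lemma borel_baire_coord2 (Q : nat -> nat -> Prop) k l : borel_baire [set s | Q (s k)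
  (s l)].
Proof.
have -> : [set s : baire | Q (s k) (s l)] =
    [set s | exists p : nat * nat, Q p.1 p.2 /\ (s k = p.1 /\ s l = p.2)].
  apply/seteqP; split=> s /= => [Qs|[[u v] /= [Quv [-> ->]]]] //.
  by exists (s k, s l).
apply: borel_baire_exists => p; apply: borel_baireI; first exact: borel_baire_cst.
by apply: borel_baireI; exact: borel_baire_gen.
Qed.

Lemma open_metric_ball (R : realType) (P : metricType R) (p : P) (e : R) :
  open [set q | (mdist p q < e)%R].
Proof.
rewrite openE => q /= pq; apply/nbhs_ballP; exists (e - mdist p q)%R => /=.
  by rewrite subr_gt0.
rewrite ballEmdist => r /= qr; apply: le_lt_trans (metric_triangle p q r) _.
by rewrite -ltrBrDl.
Qed.

Section Coding.
Variables (R : realType) (P : metricType R).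
Hypothesis completeP : forall F : set_system P,
  ProperFilter F -> cauchy F -> exists p : P, F --> p.
Variable d : nat -> P.
Hypothesis dense_d : forall p (e : R), (0 < e)%R -> exists i, (mdist (d i) p < e)%R.
Local Open Scope ring_scope.

Let rad n : R := 2 ^- n.

Let rad_gt0 n : 0 < rad n. Proof. by rewrite invr_gt0 exprn_gt0. Qed.

(* The code of [p] lists which basic balls contain [p]. *)
Definition metric_code (p : P) : baire := fun m =>
  if @unpickle (nat * nat)%type m is Some (i, n) then (`[< mdist (d i) p < rad n >] :
    nat) else 0%N.

Lemma metric_code_inj : injective metric_code.
Proof.
move=> p q pq; apply: contrapT => npq.
have : 0 < mdist p q by rewrite mdist_gt0; exact/eqP.
move=> pq0; have [n ne] := exp2V_small (divr_gt0 pq0 (ltr0Sn R 1)).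
have [i ip] := dense_d p (rad_gt0 n).
have /(congr1 (fun s => s (pickle (i, n)))) := pq; rewrite /metric_code pickleK.
rewrite (asboolT ip); case: asboolP => // iq _.
have : mdist p q < rad n + rad n.
  apply: le_lt_trans (metric_triangle p (d i) q) _.
  by rewrite metric_sym ltrD.
apply/negP; rewrite -leNgt (splitr (mdist p q)); apply: lerD; exact: ltW.
Qed.

Lemma open_metric_code (O : set P) : open O -> borel_preimages metric_code O.
Proof.
move=> oO; exists [set s | exists p : nat * nat,
    (forall q, mdist (d p.1) q < rad p.2 -> O q) /\ s (pickle p) = 1%N].
  apply: borel_baire_exists => p; apply: borel_baireI; first exact: borel_baire_cst.
  exact: borel_baire_gen.
apply/seteqP; split=> p /=; last first.
  move=> [[i n] /= [inO]]; rewrite /metric_code pickleK.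
  by case: asboolP => // ip _; exact: inO.
move=> Op; have : nbhs p O by exact: open_nbhs_nbhs.
move=> /nbhs_ballP[e /= e0]; rewrite ballEmdist => peO.
have [n ne] := exp2V_small (divr_gt0 e0 (ltr0Sn R 1)).
have [i ip] := dense_d p (rad_gt0 n).
exists (i, n); split=> /=.
  move=> q iq; apply: peO => /=; apply: le_lt_trans (metric_triangle p (d i) q) _.
  by rewrite (splitr e) metric_sym ltrD// (lt_trans _ ne).
by rewrite /metric_code pickleK asboolT.
Qed.

Lemma metric_code_open k m (M : set_system P) : sigma_algebra setT M -> @open P `<=` M ->
  M [set p | metric_code p k = m].
Proof.
move=> MS oM; have [M0 MC MU] := MS.
have MT : M setT by rewrite -(setD0 setT); exact: MC.
rewrite /metric_code; case: unpickle => [[i n]|]; last first.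
  have [m0|m0] := pselect (0%N = m).
    by have -> : [set _ : P | 0%N = m] = setT by apply/seteqP; split.
  by have -> : [set _ : P | 0%N = m] = set0 by apply/seteqP; split.
have MB : M [set p | mdist (d i) p < rad n] by apply: oM; exact: open_metric_ball.
case: m => [|[|m]].
- have -> : [set p | (`[< mdist (d i) p < rad n >] : nat) = 0%N] =
      setT `\` [set p | mdist (d i) p < rad n].
    by apply/seteqP; split=> p /=; case: asboolP => // ? [].
  exact: MC.
- have -> : [set p | (`[< mdist (d i) p < rad n >] : nat) = 1%N] =
      [set p | mdist (d i) p < rad n].
    by apply/seteqP; split=> p /=; case: asboolP.
  by [].
- have -> : [set p | (`[< mdist (d i) p < rad n >] : nat) = m.+2] = set0.
    by apply/seteqP; split=> p //=; case: asboolP.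
  by [].
Qed.

Lemma fast_cauchy_limit (c : nat -> nat) :
  (forall k l, mdist (d (c k)) (d (c l)) <= rad k + rad l) ->
  exists p, forall k, mdist (d (c k)) p <= rad k.
Proof.
move=> cP; pose F : set_system P := (d \o c) @ \oo.
have rad_small e : 0 < e -> exists N, forall k, (N <= k)%N -> rad k < e.
  move=> e0; have [N Ne] := exp2V_small e0; exists N => k Nk.
  apply: le_lt_trans Ne; rewrite /rad lef_pV2 ?posrE ?exprn_gt0//.
  by rewrite ler_eXn2l ?ltr1n.
have [|p Fp] := @completeP F _.
  apply: cauchy_exP => e e0; have [N NP] := rad_small _ (divr_gt0 e0 (ltr0Sn R 1)).
  exists (d (c N)); exists N => // k /= Nk; rewrite ballEmdist /=.
  apply: le_lt_trans (cP N k) _; rewrite (splitr e) ltrD//; exact: NP.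
exists p => k; apply/ler_addgt0Pr => e e0.
have e20 : 0 < e / 2 by exact: divr_gt0.
have : F (ball p (e / 2)) by apply: Fp; exact: nbhsx_ballx.
move=> [N1 _ N1P]; have [N2 N2P] := rad_small _ e20.
pose l := maxn N1 N2.
have lp : mdist (d (c l)) p < e / 2.
  have := N1P l (leq_maxl _ _); rewrite /= ballEmdist /= => H.
  by rewrite metric_sym.
apply: le_trans (metric_triangle _ (d (c l)) _) _.
rewrite (splitr e) addrA; apply: lerD (ltW lp).
apply: le_trans (cP k l) _; rewrite lerD2l; apply/ltW/N2P; exact: leq_maxr.
Qed.

(** A code is certified by a fast Cauchy sequence of dense points, which converges by completeness.
    Membership of the limit in an open ball is a countable disjunction over the approximations, so
    the condition on sequence and code is Borel. *)
Lemma metric_code_analytic : analytic (range metric_code).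
Proof.
pose Q (i n k v : nat) := mdist (d v) (d i) + rad k < rad n.
pose fastc := [set z : baire | forall kl : nat * nat,
  mdist (d (slice false z kl.1)) (d (slice false z kl.2)) <= rad kl.1 + rad kl.2].
pose codes := [set z : baire | forall m,
  if @unpickle (nat * nat)%type m is Some (i, n)
  then ((exists k, Q i n k (slice false z k)) /\ slice true z m = 1%N) \/
       ((forall k, ~ Q i n k (slice false z k)) /\ slice true z m = 0%N)
  else slice true z m = 0%N].
have key c p i n : (forall k, mdist (d (c k)) p <= rad k) ->
    (mdist (d i) p < rad n <-> exists k, Q i n k (c k)).
  move=> cp; split=> [ip|[k Qk]]; last first.
    apply: le_lt_trans (metric_triangle _ (d (c k)) _) _; rewrite (metric_sym (d i)).
    by apply: le_lt_trans Qk; rewrite lerD2l.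
  have e0 : 0 < (rad n - mdist (d i) p) / 2 by rewrite divr_gt0// subr_gt0.
  have [k ke] := exp2V_small e0; exists k; rewrite /Q.
  have -> : rad n = mdist (d i) p + ((rad n - mdist (d i) p) / 2 + (rad n - mdist (d
    i) p) / 2).
    by rewrite -splitr subrKC.
  apply: le_lt_trans (_ : mdist (d i) p + (rad k + rad k) < _).
    rewrite addrA lerD2r; apply: le_trans (metric_triangle _ p _) _.
    by rewrite (metric_sym (d i)) addrC; apply: lerD.
  by rewrite ltrD2l ltrD.
have -> : range metric_code = [set y | exists c, (fastc `&` codes) (interleave c y)].
  apply/seteqP; split=> y.
    move=> [p _ <-]; have /choice[c cP] k : exists i,
      mdist (d i) p < rad k by exact: dense_d.
    have cp k : mdist (d (c k)) p <= rad k by exact: ltW.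
    exists c; split=> [kl|m]; rewrite interleave1 ?interleave2.
      apply: le_trans (metric_triangle _ p _) _.
      by rewrite lerD// metric_sym.
    rewrite /metric_code; case: unpickle => [[i n]|] //.
    case: asboolP => [/(key c p i n cp)|nip]; first by left.
    by right; split=> // k Qk; apply/nip/(key c p i n cp); exists k.
  move=> [c [fc cc]]; have [|p cp] := @fast_cauchy_limit c.
    by move=> k l; have := fc (k, l); rewrite interleave1.
  exists p => //; apply/funext => m; have := cc m;
    rewrite interleave1 interleave2 /metric_code.
  case: unpickle => [[i n]|] //; case: asboolP => [/(key c p i n cp)[k Qk]|nip].
    by move=> [[_ ->]|[/(_ k)]].
  by move=> [[[k Qk] _]|[_ ->]] //; case: nip; apply/(key c p i n cp); exists k.
apply/analytic_ex/borel_analytic/borel_baireI.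
  apply: borel_baire_forall => -[k l].
  exact: (@borel_baire_coord2 (fun u v => mdist (d u) (d v) <= rad k + rad l)).
apply: borel_baire_forall => m; case: unpickle => [[i n]|]; last exact: borel_baire_gen.
have bQ k : borel_baire [set z : baire | Q i n k (slice false z k)].
  exact: (@borel_baire_coord2 (fun u _ => Q i n k u) _ 0%N).
apply: borel_baireU; apply: borel_baireI; do ?exact: borel_baire_gen.
  exact: borel_baire_exists.
by apply: borel_baire_forall => k; exact: (borel_baireC (bQ k)).
Qed.

End Coding.

Lemma standard_borel_code (R : realType) (X : mspace) : standard_borel R X ->
  exists j : X -> baire, [/\ injective j, borel X = borel_preimages j &
    analytic (range j)].
Proof.
move=> [P [f [[[D cD dD] compl] bij_f bX]]].
(* The enumeration of the dense set needs a default point, hence the separate empty case. *)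
have [[x0 _]|nX] := pselect (exists x : X, True); last first.
  have all0 (A B : set X) : A = B by apply/seteqP; split=> x; case: nX; exists x.
  exists (fun=> fun=> 0%N); split.
  - by move=> x; case: nX; exists x.
  - have [b0 _ _] := borel_sigma X.
    apply/seteqP; split=> A _; last by rewrite (all0 A set0).
    by exists [set _ | True]; [exact: borel_baire_cst|exact: all0].
  - have -> : range (fun _ : X => fun _ : nat => 0%N) = [set _ | False].
      by apply/seteqP; split=> s //= [x]; case: nX; exists x.
    exact: analytic_cst.
have /countable_injP[g gI] := cD.
have /choice[d dP] n : exists p : P, forall y, D y -> g y = n -> p = y.
  have [[y Dy gy]|H] := pselect (exists2 y, D y & g y = n).
    by exists y => z Dz gz; apply: gI; rewrite ?inE// gy.
  by exists (f x0) => y Dy gy; case: H; exists y.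
have dense_d p (e : R) : (0 < e)%R -> exists i, (mdist (d i) p < e)%R.
  move=> e0; have [||q [pq Dq]] := dD [set q | (mdist p q < e)%R].
  - by exists p; rewrite /= mdistxx.
  - exact: open_metric_ball.
  by exists (g q); rewrite (dP _ q)// metric_sym.
exists (metric_code d \o f); split.
- by apply: inj_comp; [exact: metric_code_inj|exact: bij_inj].
- rewrite bX; apply/seteqP; split=> A.
    move=> [B]; have : <<s @open P >> `<=` borel_preimages (metric_code d).
      apply: smallest_sub; first exact: borel_preimages_sigma.
      by move=> O; exact: open_metric_code.
    by move=> /[apply] -[C bC ->] <-; exists C.
  move=> [C bC ->]; exists (metric_code d @^-1` C) => //.
  apply: sigma_algebra_borel_baire bC; first exact: smallest_sigma_algebra.
  move=> k m; apply: metric_code_open; first exact: smallest_sigma_algebra.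
  exact: sub_sigma_algebra.
- have -> : range (metric_code d \o f) = range (metric_code d).
    have [f' _ f'K] := bij_f.
    apply/seteqP; split=> s [x _ <-]; first by exists (f x).
    by exists (f' x) => //=; rewrite f'K.
  exact: metric_code_analytic.
Qed.

(** * Transfer to Borel graphs *)

Lemma isomorphic_range (L H : graph) (v : H -> L) : injective v ->
  (forall i j, adj i j <-> adj (v i) (v j)) -> contains_copy L H.
Proof.
move=> vI vadj; exists (range v).
have /choice[f fP] (u : set_type (range v)) : exists i, v i = set_val u.
  by have [i _ iu] := set_valP u; exists i.
exists f; split; last by move=> x y; rewrite vadj !fP.
have g i : v i \in range v by apply/mem_set; exists i.
exists (fun i => SigSub (g i)) => [u|i].
  by apply/val_inj; rewrite /= fP.
by apply: vI; rewrite fP.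
Qed.

Lemma edge_list_copy (L : graph) n s (v : nat -> L) :
  (forall i j, (i < j < n)%N -> v i <> v j) ->
  (forall i j, (i < j < n)%N -> adj (v i) (v j) <-> ((i, j) \in s) || ((j, i) \in s)) ->
  contains_copy L (edge_list_graph n s).
Proof.
move=> vne vadj; apply: (@isomorphic_range L (edge_list_graph n s) (fun i : 'I_n => v i)).
  move=> i j vij; apply/val_inj; case: (ltngtP i j) => // ij; exfalso.
    by apply: (vne i j) => //; rewrite ij /=.
  by apply: (vne j i) => //; rewrite ij /=.
move=> i j; rewrite /= /edge_list_adj -val_eqE /=; case: (ltngtP i j) => ij /=.
- by split=> /vadj; apply; rewrite ij /=.
- split=> [H|/adj_sym H]; first by apply/adj_sym/vadj; [rewrite ij /=|rewrite orbC].
  by rewrite orbC; apply/vadj => //; rewrite ij /=.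
- by split=> // vij; case: (@adj_irr L (v i)); rewrite {2}ij.
Qed.

Lemma beineke_claw_free (L : graph) : (forall i : 'I_9, ~ contains_copy L (beineke i)) ->
  forall x y1 y2 y3 : L, adj x y1 -> adj x y2 -> adj x y3 ->
  y1 <> y2 -> y1 <> y3 -> y2 <> y3 -> [\/ adj y1 y2, adj y1 y3 | adj y2 y3].
Proof.
move=> LB x y1 y2 y3 a1 a2 a3 n12 n13 n23; apply: contrapT => nadj.
have m12 : ~ adj y1 y2 by move=> ?; apply: nadj; constructor 1.
have m13 : ~ adj y1 y3 by move=> ?; apply: nadj; constructor 2.
have m23 : ~ adj y2 y3 by move=> ?; apply: nadj; constructor 3.
have adj_neq (u w : L) : adj u w -> u <> w by move=> /[swap] -> /adj_irr.
apply: (LB (@Ordinal 9 0 isT)); apply: (@edge_list_copy L 4 _ (nth x [:: x; y1; y2; y3])).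
  by move=> [|[|[|[|i]]]] [|[|[|[|j]]]] /andP[] // _ _ /=; exact: adj_neq.
by move=> [|[|[|[|i]]]] [|[|[|[|j]]]] /andP[].
Qed.

Lemma beineke_K5e_free (L : graph) : (forall i : 'I_9, ~ contains_copy L (beineke i)) ->
  forall a b c d e : L, adj c d -> adj c e -> adj d e ->
  adj a c -> adj a d -> adj a e -> adj b c -> adj b d -> adj b e -> a <> b -> adj a b.
Proof.
move=> LB a b c d e cd ce de ac ad ae bc bd be ab; apply: contrapT => nab.
have adj_neq (u w : L) : adj u w -> u <> w by move=> /[swap] -> /adj_irr.
(* Index 6 is [B7], whose missing edge joins the first two vertices. *)
apply: (LB (@Ordinal 9 6 isT)); apply: (@edge_list_copy L 5 _ (nth a [:: a; b; c; d; e])).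
  by move=> [|[|[|[|[|i]]]]] [|[|[|[|[|j]]]]] /andP[] // _ _ /=; exact: adj_neq.
by move=> [|[|[|[|[|i]]]]] [|[|[|[|[|j]]]]] /andP[].
Qed.

(* By Koenig's lemma the image of a cylinder is closed. *)
Lemma cylinder_image_borel (psi : cantor -> baire) p : cont psi ->
  borel_baire [set s | exists2 a, starts p a & psi a = s].
Proof.
move=> cpsi.
have -> : [set s | exists2 a, starts p a & psi a = s] =
    [set s : baire | forall n, exists u : n.-tuple nat,
      (forall i : 'I_n, s i = tnth u i) /\
      exists2 a, starts p a & forall i : 'I_n, psi a i = tnth u i].
  apply/seteqP; split=> s /=.
    move=> [a pa <-] n; exists [tuple psi a i | i < n].
    by split; [|exists a] => // i; rewrite tnth_mktuple.
  move=> H; pose good t := forall n, exists2 a, starts t a & agree n (psi a) s.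
  have good_p : good p.
    move=> n; have [u [su [a pa au]]] := H n; exists a => // k kn.
    by rewrite (au (Ordinal kn)) -(su (Ordinal kn)).
  (* If neither extension were good, an approximation to the larger of the two refuting depths would
     still pass through one of them. *)
  have good_ext t : good t -> exists i, good (rcons t i).
    move=> gt; apply: contrapT => /forallNP ng.
    have [/existsNP[n nP] /existsNP[m mP]] := (ng true, ng false).
    have [a ta aP] := gt (maxn n m).
    have tS : starts (rcons t (a (size t))) a.
      move=> k; rewrite size_rcons ltnS leq_eqVlt nth_rcons => /predU1P[->|kt].
        by rewrite ltnn eqxx.
      by rewrite kt ta.
    case: (a (size t)) tS => tS; [apply: nP|apply: mP]; exists a => //.
      by apply: agreeW aP; exact: leq_maxl.
    by apply: agreeW aP; exact: leq_maxr.
  have [|f [f0 fg fS]] := @dependent_choice_nat (seq bool) (fun _ => good)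
    (fun _ t t' => exists i, t' = rcons t i) p good_p.
    by move=> _ t /good_ext[i gi]; exists (rcons t i) => //; exists i.
  have [||a aP] := @string_chain f.
  - by move=> n; have [i ->] := fS n; exists [:: i]; rewrite cats1.
  - by elim=> // n IH; have [i ->] := fS n; rewrite size_rcons.
  exists a; first by rewrite -f0; exact: aP.
  apply: agree_eq => n; have [m mP] := cont_agree cpsi a n.
  have fm : (m <= size (f m))%N by elim: {mP} m => // k IH; have [i ->] := fS k;
    rewrite size_rcons.
  have [b fb bs] := fg m n; apply: agree_trans bs; apply: mP => k km.
  by rewrite -fb ?aP// (leq_trans km).
apply: borel_baire_forall => n; apply: borel_baire_exists => u.
apply: borel_baireI; last exact: borel_baire_cst.
by apply: borel_baire_forall => i; exact: borel_baire_gen.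
Qed.

Section Transfer.
Variables (R : realType) (L : mgraph).
Hypotheses (L_borel : borel_graph R L) (L_lc : locally_countable L).
Hypothesis L_beineke : forall i : 'I_9, ~ contains_copy L (beineke i).
Variable j : L -> baire.
Hypotheses (jI : injective j) (jB : @vborel L = borel_preimages j) (jA : analytic
  (range j)).

Definition code_adj (s t : baire) := exists x y : L, [/\ j x = s, j y = t & adj x y].

Lemma code_adjE x y : code_adj (j x) (j y) <-> adj x y.
Proof. by split=> [[x' [y' [/jI -> /jI ->]]]|xy] //; exists x, y. Qed.

Lemma code_adj_sym s t : code_adj s t -> code_adj t s.
Proof. by move=> [x [y [xs yt /adj_sym xy]]]; exists y, x. Qed.

Lemma code_adj_irr s : ~ code_adj s s.
Proof. by move=> [x [y [<- /jI ->]]]; exact: adj_irr. Qed.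

Lemma code_adj_borel : exists2 B, borel_baire B &
  forall s t, code_adj s t <-> [/\ range j s, range j t & B (interleave s t)].
Proof.
have : prod_borel (X := vspace L) (Y := vspace L) `<=`
    borel_preimages (fun xy : L * L => interleave (j xy.1) (j xy.2)).
  apply: smallest_sub; first exact: borel_preimages_sigma.
  rewrite /vspace /= jB => _ [_ [A bA ->] [_ [B bB ->] <-]].
  exists (slice false @^-1` A `&` slice true @^-1` B).
    by apply: borel_baireI; apply: borel_baire_preimage => //; exact: cont_slice.
  by apply/seteqP; split=> -[x y] /=; rewrite interleave1 interleave2.
have [_ bL] := L_borel => /(_ _ bL)[B bB LB]; exists B => // s t.
have adjB (x y : L) : adj x y <-> B (interleave (j x) (j y)).
  by have := congr1 (fun A => A (x, y)) LB; rewrite /= => ->.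
split=> [[x [y [<- <- /adjB]]]|[[x _ <-] [y _ <-] /adjB]]; first by split.
by exists x, y.
Qed.

Lemma code_adj_countable s : exists e : nat -> baire, forall t,
  code_adj s t -> exists i, t = e i.
Proof.
have [[x _ <-]|ns] := pselect (range j s); last first.
  by exists (fun=> s) => t [x [y [xs _ _]]]; case: ns; exists x.
have /countable_injP[g gI] := L_lc x.
have /choice[e eP] n : exists u : baire, forall y, adj x y -> g y = n -> u = j y.
  have [[y xy gy]|H] := pselect (exists2 y, adj x y & g y = n).
    by exists (j y) => z xz gz; congr j; apply: gI; rewrite ?inE// gy.
  by exists (j x) => y xy gy; case: H; exists y.
exists e => t [x' [y [/jI -> <- xy]]]; exists (g y).
by rewrite (eP _ y).
Qed.

Lemma code_adj_claw_free x y1 y2 y3 : code_adj x y1 -> code_adj x y2 -> code_adj x y3 ->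
  y1 <> y2 -> y1 <> y3 -> y2 <> y3 -> [\/ code_adj y1 y2,
    code_adj y1 y3 | code_adj y2 y3].
Proof.
move=> [u [v1 [<- <- a1]]] [u2 [v2 [/jI -> <- a2]]] [u3 [v3 [/jI -> <- a3]]] n12 n13 n23.
have jne (u' w : L) : j u' <> j w -> u' <> w by move=> ne E; apply: ne; rewrite E.
have [H|H|H] := beineke_claw_free L_beineke a1 a2 a3 (jne _ _ n12) (jne _ _ n13) (jne
  _ _ n23).
- by constructor 1; apply/code_adjE.
- by constructor 2; apply/code_adjE.
- by constructor 3; apply/code_adjE.
Qed.

Lemma code_adj_K5e_free a b c d e : code_adj c d -> code_adj c e -> code_adj d e ->
  code_adj a c -> code_adj a d -> code_adj a e -> code_adj b c -> code_adj b d ->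
    code_adj b e ->
  a <> b -> code_adj a b.
Proof.
move=> [c' [d' [<- <- cd]]] [_ [e' [/jI -> <- ce]]] [_ [_ [/jI -> /jI -> de]]].
move=> [a' [_ [<- /jI -> ac]]] [_ [_ [/jI -> /jI -> ad]]] [_ [_ [/jI -> /jI -> ae]]].
move=> [b' [_ [<- /jI -> bc]]] [_ [_ [/jI -> /jI -> bd]]] [_ [_ [/jI -> /jI -> be]]] ab.
apply/code_adjE/(beineke_K5e_free L_beineke cd ce de ac ad ae bc bd be) => E.
by apply: ab; rewrite E.
Qed.

(** The isomorphism onto [K0] inverts [psi], so its measurability rests on images of open sets being
    Borel: an open set is a countable union of cylinders, whose images are Borel. *)
Lemma K0_embedding_borel_copy (psi : cantor -> baire) : cont psi -> injective psi ->
  (forall a, range j (psi a)) ->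
  (forall a b, code_adj (psi a) (psi b) <-> a <> b /\ eventually_eq a b) ->
  contains_borel_copy L K0.
Proof.
move=> cpsi ipsi jpsi adjpsi.
have /choice[x xP] a : exists u, j u = psi a by have [u _ <-] := jpsi a; exists u.
have xI : injective x by move=> a b ab; apply: ipsi; rewrite -!xP ab.
exists (range x); split.
  rewrite jB; exists [set s | exists2 a, starts [::] a & psi a = s].
    exact: cylinder_image_borel.
  apply/seteqP; split=> u /=; first by move=> [a _ <-]; exists a.
  by move=> [a _]; rewrite -xP => /jI <-; exists a.
have /choice[f fP] (u : set_type (range x)) : exists a, x a = set_val u.
  by have [a _ au] := set_valP u; exists a.
exists (f : induced_mgraph (range x) -> K0); split.
  split.
    have g a : x a \in range x by apply/mem_set; exists a.
    exists (fun a => SigSub (g a)) => [u|a]; first by apply/val_inj; rewrite /= fP.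
    by apply: xI; rewrite fP.
  move=> u w; rewrite /= -[set_val u]fP -[set_val w]fP -code_adjE !xP adjpsi.
  by [].
have : <<s @open cantor_space >> `<=` borel_preimages psi.
  apply: smallest_sub; first exact: borel_preimages_sigma.
  move=> O oO; exists [set s | exists p : seq bool,
      (forall a, starts p a -> O a) /\ (exists2 a, starts p a & psi a = s)].
    apply: borel_baire_exists => p; apply: borel_baireI; first exact: borel_baire_cst.
    exact: cylinder_image_borel.
  apply/seteqP; split=> a /=; last by move=> [p [pO [b pb /ipsi <-]]]; exact: pO.
  move=> Oa; have : nbhs (a : cantor_space) O by exact: open_nbhs_nbhs.
  move=> /cantor_space_nbhs[n nO]; exists (mkseq a n); split; last first.
    by exists a => //; exact: starts_mkseq.
  by move=> b /starts_agree ab; apply: nO => k kn; exact: ab.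
move=> sB B /sB[C bC BC]; exists (j @^-1` C); first by rewrite /= jB; exists C.
apply/seteqP; split=> u /=.
  by rewrite BC -fP xP => -[].
by rewrite BC -fP xP.
Qed.

End Transfer.

(** * Borel chromatic numbers *)

Section DiscreteMetric.
Variables (R : realType) (T : countType).
Local Open Scope ring_scope.

Definition discrete_metric : Type := T.

HB.instance Definition _ := Choice.on discrete_metric.

Implicit Types a b c : discrete_metric.

Definition discrete_dist a b : R := (a != b)%:R.

Lemma discrete_distxx a : discrete_dist a a = 0.
Proof. by rewrite /discrete_dist eqxx. Qed.

Lemma discrete_dist_lt1 a b : discrete_dist a b < 1 -> a = b.
Proof. by rewrite /discrete_dist; case: eqP => //= _; rewrite ltxx. Qed.

Lemma discrete_dist_pos a b : discrete_dist a b = 0 -> a = b.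
Proof. by move=> ab; apply: discrete_dist_lt1; rewrite ab ltr01. Qed.

Lemma discrete_dist_sym a b : discrete_dist a b = discrete_dist b a.
Proof. by rewrite /discrete_dist eq_sym. Qed.

Lemma discrete_dist_triangle b a c :
  discrete_dist a c <= discrete_dist a b + discrete_dist b c.
Proof.
rewrite /discrete_dist -natrD ler_nat; have [->|ab] := eqVneq a b; first by [].
exact: leq_trans (leq_b1 _) (leq_addr _ _).
Qed.

HB.instance Definition _ := isMetric.Build R discrete_metric
  discrete_distxx discrete_dist_pos discrete_dist_sym discrete_dist_triangle.

Lemma discrete_metric_ball a : ball a (1 : R) = [set a].
Proof.
rewrite ballEmdist; apply/seteqP; split=> b /= => [/discrete_dist_lt1 //|->].
by rewrite [mdist _ _]discrete_distxx ltr01.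
Qed.

Lemma discrete_metric_open (A : set discrete_metric) : open A.
Proof.
rewrite openE => a Aa; apply/nbhs_ballP; exists (1 : R) => //=.
by rewrite discrete_metric_ball => _ ->.
Qed.

Lemma discrete_metric_separable_complete :
  separable_complete (discrete_metric : metricType R).
Proof.
split.
  by exists setT; [exact: (@countableP T)|move=> O [a Oa] _; exists a].
move=> F PF /cauchyP/(_ 1 ltr01)[a aF]; exists a => A /nbhs_singleton Aa.
by apply: filterS aF; rewrite discrete_metric_ball => _ ->.
Qed.

End DiscreteMetric.

Lemma discrete_sigma (T : Type) : sigma_algebra setT [set: set T].
Proof. by []. Qed.

Definition discrete_space (T : Type) : mspace := MSpace (discrete_sigma T).

Lemma discrete_standard_borel (R : realType) (T : countType) :
  standard_borel R (discrete_space T).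
Proof.
exists (discrete_metric T : metricType R), id; split.
- exact: discrete_metric_separable_complete.
- by exists id.
- apply/seteqP; split=> A // _; exists A => //.
  by apply: sub_sigma_algebra; exact: discrete_metric_open.
Qed.

Lemma standard_borel_set1 (R : realType) (X : mspace) (x : X) :
  standard_borel R X -> borel X [set x].
Proof.
move=> /standard_borel_code[j [jI -> _]]; exists [set s | forall k, s k = j x k].
  by apply: borel_baire_forall => k; exact: borel_baire_gen.
apply/seteqP; split=> y /=; first by move=> ->.
by move=> /funext/jI.
Qed.

Lemma mspace_exists (X : mspace) (I : countType) (F : I -> set X) :
  (forall i, borel X (F i)) -> borel X [set x | exists i, F i x].
Proof.
move=> bF; have [b0 _ bU] := borel_sigma X.
have -> : [set x | exists i, F i x] =
    \bigcup_n (if @unpickle I n is Some i then F i else set0).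
  apply/seteqP; split=> x /= => [[i Fi]|[n _]].
    by exists (pickle i) => //; rewrite pickleK.
  by case: unpickle => // i Fi; exists i.
by apply: bU => n; case: unpickle.
Qed.

Lemma borel_colorable_discrete (G : mgraph) (T : countType) (f : G -> T) :
  (forall i, @vborel G (f @^-1` [set i])) -> (forall x y, adj x y -> f x <> f y) ->
  borel_colorable G (discrete_space T).
Proof.
move=> bf fP; exists f; split=> // A _.
have -> : f @^-1` A = [set x | exists i, (f @^-1` [set i] `&` [set _ | A i]) x].
  by apply/seteqP; split=> x /= => [Ax|[_ [<-]]] //; exists (f x).
apply: (@mspace_exists (vspace G)) => i; have [b0 _ _] := vborel_sigma G.
have [Ai|nAi] := pselect (A i).
  rewrite (_ : _ `&` _ = f @^-1` [set i]); first exact: bf.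
  by apply/seteqP; split=> x //= [].
by rewrite (_ : _ `&` _ = set0)//; apply/seteqP; split=> x //= [].
Qed.

Lemma colorable_finite (R : realType) (G : mgraph) (Y : mspace) m :
  standard_borel R Y -> borel_colorable G Y -> [set: Y] #= `I_m ->
  borel_colorable G (discrete_space 'I_m).
Proof.
move=> sY [g [bg gP]] /card_set_bijP[h [hm hI hS]].
have hlt y : (h y < m)%N by exact: hm.
apply: (@borel_colorable_discrete G 'I_m (fun x => Ordinal (hlt (g x)))) => [i|x y xy].
  have [y _ hy] := hS i (ltn_ord i).
  have := bg _ (standard_borel_set1 y sY); congr (vborel _); apply/seteqP; split=> x /=.
    by move=> gx; apply/val_inj; rewrite /= gx.
  by move=> /(congr1 val) /= hx; apply: hI; rewrite ?inE// hx.
by move=> /(congr1 val) /= hxy; apply: (gP x y xy); apply: hI; rewrite ?inE.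
Qed.

(** The bound asks for a colour space of least cardinality: the smallest finite one if some finite
    colouring exists, and the natural numbers otherwise. *)
Lemma countable_chromatic_number (R : realType) (G : mgraph) :
  borel_colorable G (discrete_space nat) -> borel_chromatic_number_le R G nat.
Proof.
move=> cG.
have lower (n : nat) (Y : mspace) : standard_borel R Y -> borel_colorable G Y ->
    (forall m, borel_colorable G (discrete_space 'I_m) -> (n <= m)%N) ->
      `I_n #<= [set: Y].
  move=> sY cY nP; have [/finite_setP[m Ym]|/infiniteP iY] :=
    pselect (finite_set [set: Y]).
    have nm := nP m (colorable_finite sY cY Ym).
    by move/card_eqPle: Ym => [_]; apply: card_le_trans; rewrite card_le_II.
  by apply: card_le_trans iY; exact: card_leT.
have [[n cn]|ninf] := pselect (exists n, borel_colorable G (discrete_space 'I_n));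
  last first.
  exists (discrete_space nat); last exact: card_lexx.
  split=> //; first exact: (@discrete_standard_borel R nat).
  move=> Y sY cY; apply/infiniteP => /finite_setP[m Ym]; apply: ninf; exists m.
  exact: colorable_finite sY cY Ym.
have ex : exists n, `[< borel_colorable G (discrete_space 'I_n) >] by exists n;
  apply/asboolP.
case: (ex_minnP ex) => k /asboolP ck kmin.
exists (discrete_space 'I_k); last by apply: countableP.
split=> //; first exact: (@discrete_standard_borel R 'I_k).
move=> Y sY cY; apply: card_le_trans (lower k Y sY cY _).
  by have /card_eqPle[] := @card_II k.
by move=> m cm; apply: kmin; apply/asboolP.
Qed.

(** Colouring by the first covering set makes the classes Borel, and independence of the covering
    sets makes the colouring proper. *)
Lemma small_borel_colorable (G : mgraph) (j : G -> baire) (H : baire -> baire -> Prop) :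
  @vborel G = borel_preimages j -> (forall x y, adj x y -> H (j x) (j y)) ->
  small H setT -> borel_colorable G (discrete_space nat).
Proof.
move=> jB adjH [B BP BT].
have ex x : exists n, `[< B n (j x) >] by have [n Bn] := BT (j x) I; exists n;
  apply/asboolP.
pose f x := ex_minn (ex x).
apply: (@borel_colorable_discrete G nat f) => [n|x y xy].
  rewrite jB; exists [set s | B n s /\ forall m : 'I_n, ~ B m s].
    apply: borel_baireI; first by have [] := BP n.
    by apply: borel_baire_forall => m; apply: borel_baireC; have [] := BP m.
  apply/seteqP; split=> x /=; rewrite /f; case: ex_minnP => k /asboolP Bk kmin.
    move=> <-; split=> // m /asboolP /kmin; by rewrite leqNgt ltn_ord.
  move=> [Bn nB]; apply/eqP; rewrite eqn_leq kmin; last exact/asboolP.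
  by rewrite leqNgt; apply/negP => kn; apply: (nB (Ordinal kn)).
rewrite /f; case: ex_minnP => k /asboolP Bk _; case: ex_minnP => l /asboolP Bl _ kl.
by have [_ iB] := BP k; rewrite -kl in Bl; exact: iB Bk Bl (adjH _ _ xy).
Qed.

Theorem corollary1p6 (R : realType) (L : mgraph)
    (L_borel : borel_graph R L) (L_lc : locally_countable L)
    (L_beineke : forall i : 'I_9, ~ contains_copy L (beineke i))
    (L_K0 : ~ contains_borel_copy L K0) :
  borel_chromatic_number_le R L nat.
Proof.
apply: countable_chromatic_number.
have [j [jI jB jA]] := standard_borel_code (proj1 L_borel).
have adjj x y : adj x y -> code_adj j (j x) (j y) by move=> xy; exists x, y.
apply: (small_borel_colorable jB adjj).
have [Ghat bG GE] := code_adj_borel L_borel jB.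
have sym := @code_adj_sym _ j; have irr := @code_adj_irr _ j jI.
have claw := code_adj_claw_free L_beineke jI.
have K5e := code_adj_K5e_free L_beineke jI.
have [sM|[Phi cPhi hPhi]] := g0_dichotomy (analytic_clique_rel jA bG GE).
  exact: small_clique_rel jA bG GE sym irr claw K5e sM.
have [psi [cpsi ipsi Vpsi adjpsi]] :=
  clique_hom_K0_embedding bG GE sym irr K5e (code_adj_countable L_lc jI) cPhi hPhi.
by case: L_K0; exact: (K0_embedding_borel_copy jI jB cpsi ipsi Vpsi adjpsi).
Qed.
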